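(* Let $m\ge1$, $n_1,\ldots,n_m\ge 1$, $D\ge1$, $K\ge1$, $L\ge1$ be integers and let $\nu,\gamma>0$. Let $p^{\infty\infty}(\mathbf{x})$ and $p^{KL}(\mathbf{x})$ denote the marginal distributions of the observed data $\mathbf{x}=(X^{(j)}_{gi})_{1\le j\le m,\,1\le i\le n_j,\,1\le g\le D}$ under the SCSC model and under the truncated SCSC model with truncation levels $K$ and $L$, respectively (both models are defined in the context), obtained by integrating all parameters out; in particular the cell effects $\boldsymbol\mu$ are integrated against their prior distributions $p^{\infty\infty}(\boldsymbol\mu)$ and $p^{KL}(\boldsymbol\mu)$ in the respective models. Then $$\frac14\int\left|p^{KL}(\mathbf{x})-p^{\infty\infty}(\mathbf{x})\right|d\mathbf{x}\ \le\ 1-\left\{1-\left(\frac{\nu}{\nu+1}\right)^{L-1}\right\}^m\left\{1-\left(\frac{\gamma}{\gamma+1}\right)^{K-1}\right\}^{\sum_{j=1}^m n_j}.$$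
   Context: Stick-breaking weights: for $a>0$, $\mathrm{GEM}(a)$ is the law of $(w_k)_{k\ge1}$ with $w_k=\psi_k\prod_{t<k}(1-\psi_t)$, $\psi_k$ i.i.d. $\mathrm{Beta}(1,a)$. For an integer $N\ge1$, $\mathrm{GEM}_N(a)$ is the law of $(w_1,\ldots,w_N)$ with $w_k=\psi_k\prod_{t<k}(1-\psi_t)$ for $k\le N-1$ and $w_N=1-\sum_{k<N}w_k$. $\mathrm{DP}(a,P_0)$ is the law of $\sum_{k\ge1}w_k\delta_{\theta_k}$ with $(w_k)\sim\mathrm{GEM}(a)$ and, independently, $\theta_k$ i.i.d. from $P_0$; the truncated version $\mathrm{DP}_N(a,P_0)$ is the law of $\sum_{k=1}^N w_k\delta_{\theta_k}$ with $(w_1,\ldots,w_N)\sim\mathrm{GEM}_N(a)$ and, independently, $\theta_k$ i.i.d. from $P_0$. ZIPLN distribution: for $\lambda_0\in\mathbb{R}$, $\lambda_1<0$, $s>0$, $\eta\in\mathbb{R}$, $\sigma^2>0$, $X\sim\mathrm{ZIPLN}(\lambda_0,\lambda_1,s,\eta,\sigma^2)$ means: $\theta\sim\mathrm{N}(\eta,\sigma^2)$, $Y\mid\theta\sim\mathrm{Poisson}(s e^{\theta})$, and given $Y$, $X=0$ with probability $p(Y)$ and $X=Y$ with probability $1-p(Y)$, where $p(y)=\Phi(\lambda_0+\lambda_1\log_2(y+1))$ and $\Phi$ is the standard normal distribution function. SCSC model: $\alpha>0$, and $H$ is a non-atomic probability measure on $\mathbb{R}^D$ with its Borel $\sigma$-field.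 $$G_0\sim\mathrm{DP}(\alpha,H),\qquad G^{(j)}\overset{i.i.d.}{\sim}\mathrm{DP}(\nu,\mathrm{DP}(\gamma,G_0)),\ j=1,\ldots,m,$$ $$\boldsymbol\mu_i^{(j)}=(\mu^{(j)}_{1i},\ldots,\mu^{(j)}_{Di})^\top\overset{i.i.d.}{\sim}G^{(j)},\ i=1,\ldots,n_j \text{ for each } j,$$ $$X^{(j)}_{gi}\sim\mathrm{ZIPLN}(\lambda_{g0},\lambda_{g1},s_i^{(j)},\mu^{(j)}_{gi}+\beta^{(j)}_g,\sigma_g^2)\ \text{ for each } j,i,g,$$ the $X^{(j)}_{gi}$ being conditionally independent given all parameters. Here the second relation means that $Q=\sum_{\ell\ge1}\phi_\ell\delta_{G^*_\ell}$, where $(\phi_\ell)\sim\mathrm{GEM}(\nu)$ and, independently given $G_0$, the $G^*_\ell$ are i.i.d. from $\mathrm{DP}(\gamma,G_0)$; given $Q$, each subject $j$ independently receives a subgroup index $S^{(j)}$ with $\mathbb{P}(S^{(j)}=\ell)=\phi_\ell$, and $G^{(j)}=G^*_{S^{(j)}}$. Subject effects are shared within a subgroup: $\beta_g^{(j)}=\beta_{g\ell}$ when $S^{(j)}=\ell$, with the reference subgroup effects $\beta_{g1}=0$ for all $g$. Truncated SCSC model: the same as the SCSC model except that $G^{(j)}\overset{i.i.d.}{\sim}\mathrm{DP}_L(\nu,\mathrm{DP}_K(\gamma,G_0))$, i.e. $(\phi_1,\ldots,\phi_L)\sim\mathrm{GEM}_L(\nu)$, $Q=\sum_{\ell=1}^L\phi_\ell\delta_{G_\ell^*}$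 and $G^*_1,\ldots,G^*_L$ are, given $G_0$, i.i.d. from $\mathrm{DP}_K(\gamma,G_0)$ (the law of $G_0$ is not truncated). The scaling factors $s_i^{(j)}>0$ are treated as fixed constants, and $\nu,\gamma$ are fixed. The remaining parameters ($\alpha$, hyperparameters of $H$, $\lambda_{g0}$, $\lambda_{g1}<0$, $\sigma_g^2$, and the subgroup effects $(\beta_{g\ell})_{\ell}$) have the same proper prior in both models, independent of the stick-breaking variables with parameters $\nu$ and $\gamma$ and, given $\alpha$ and $H$, independent of $G_0$ and the atoms; the truncated model uses only $\beta_{g1},\ldots,\beta_{gL}$. (In the paper: $\alpha$ has a gamma prior, $H$ is a product of $D$ copies of $\mathrm{N}(\eta_\mu,\tau_\mu^2)$ with normal and inverse-gamma hyperpriors, $\beta_{g\ell}\sim\mathrm{N}(\eta_\beta,\tau_\beta^2)$ for $\ell\ge2$ with normal and inverse-gamma hyperpriors, $\sigma_g^2$ is inverse-gamma, $\lambda_{g0}$ is normal and $\lambda_{g1}$ is normal truncated to $(-\infty,0)$.) Since the data are counts, $\int\cdots d\mathbf{x}$ is with respect to counting measure on the set of arrays of nonnegative integers. *)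

(* Defs.v *)
From HB Require Import structures.
From mathcomp Require Import all_boot all_order all_algebra finmap.
From mathcomp Require Import all_classical all_reals all_analysis.
Set Implicit Arguments.
Unset Strict Implicit.
Unset Printing Implicit Defensive.
Import Order.TTheory GRing.Theory Num.Theory.
Import numFieldNormedType.Exports.
Local Open Scope classical_set_scope.
Local Open Scope ring_scope.

(* All indices are 0-based: the sticks psi_1, psi_2, ... are psi 0, psi 1, ...,
   and the reference subgroup has label 0. *)

Section conditional_laws.
Context (R : realType) (d : measure_display) (Omega : measurableType d).

Definition events_of (I : Type) (d' : measure_display) (T : measurableType d')
    (D : set I) (W : I -> Omega -> T) : set (set Omega) :=
  \bigcup_(i in D) preimage_set_system setT (W i) measurable.

Definition events_of1 (d' : measure_display) (T : measurableType d')
    (W : Omega -> T) : set (set Omega) :=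
  preimage_set_system setT W measurable.

(* Given the sigma-algebra <<s H >>, the variables W i, i in D, are mutually
   independent and [kappa i w] is (a version of) the conditional law of W i. *)
Definition cond_indep_laws (P : probability Omega R) (H : set (set Omega))
    (I : choiceType) (d' : measure_display) (T : measurableType d')
    (D : set I) (W : I -> Omega -> T)
    (kappa : I -> Omega -> set T -> \bar R) : Prop :=
  forall (A : set Omega) (F : {fset I}) (B : I -> set T),
    <<s H >> A -> [set` F] `<=` D -> (forall i, measurable (B i)) ->
    P (A `&` \bigcap_(i in [set` F]) (W i @^-1` B i)) =
    (\int[P]_(w in A) \prod_(i <- F) kappa i w (B i))%E.

Definition cond_law (P : probability Omega R) (H : set (set Omega))
    (d' : measure_display) (T : measurableType d') (W : Omega -> T)
    (kappa : Omega -> set T -> \bar R) : Prop :=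
  cond_indep_laws P H [set: unit] (fun=> W) (fun=> kappa).

End conditional_laws.

Section stick_breaking.
Context (R : realType).

(* Beta(a, b) for real a, b > 0 (the library's [beta_prob] has natural number
   parameters). *)
Definition beta_density (a b x : R) : R := x `^ (a - 1) * (1 - x) `^ (b - 1).

Definition beta_law (a b : R) (B : set R) : \bar R :=
  ((fine (\int[lebesgue_measure]_(x in `]0%R, 1%R[)
             (beta_density a b x)%:E))^-1%:E
   * \int[lebesgue_measure]_(x in B `&` `]0%R, 1%R[) (beta_density a b x)%:E)%E.

(* A truncation level is [None] (no truncation) or [Some N] with N >= 1. *)
Definition atom_index (N : option nat) : set nat :=
  if N is Some N' then [set k | (k < N')%N] else setT.

Definition stick_index (N : option nat) : set nat :=
  if N is Some N' then [set k | (k.+1 < N')%N] else setT.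

Definition stick (psi : nat -> R) (k : nat) : R :=
  psi k * \prod_(t < k) (1 - psi t).

Definition gem_weight (N : option nat) (psi : nat -> R) (k : nat) : R :=
  if N is Some N' then
    if (k.+1 < N')%N then stick psi k
    else if k.+1 == N' then 1 - \sum_(t < k) stick psi t
    else 0
  else stick psi k.

Definition discrete_measure (d : measure_display) (T : measurableType d)
    (w : nat -> R) (theta : nat -> T) (B : set T) : \bar R :=
  (\sum_(0 <= k <oo) (w k)%:E * \d_(theta k) B)%E.

(* [M] is DP(a, P0) if [N = None] and DP_N'(a, P0) if [N = Some N']: the law of
   the random probability measure sum_k w_k delta_(theta_k).  The equality of
   [G] with that sum is almost sure, the weights summing to 1 only
   almost surely when [N = None]. *)
Definition is_DP (d : measure_display) (T : measurableType d)
    (N : option nat) (a : R) (P0 : probability T R)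
    (M : probability (pprobability T R) R) : Prop :=
  exists (d' : measure_display) (Omega : measurableType d')
    (P : probability Omega R) (psi : nat -> {mfun Omega >-> R})
    (theta : nat -> {mfun Omega >-> T})
    (G : {mfun Omega >-> pprobability T R}),
  [/\ cond_indep_laws P set0 (stick_index N) psi (fun _ _ => beta_law 1 a),
      cond_indep_laws P (events_of (stick_index N) psi) (atom_index N) theta
        (fun _ _ => P0),
      {ae P, forall w, forall B, measurable B ->
        (G w : probability T R) B =
        discrete_measure (gem_weight N (psi ^~ w)) (theta ^~ w) B} &
      forall A, measurable A -> M A = P (G @^-1` A)].

End stick_breaking.

Section zipln.
Context (R : realType).

Definition std_normal_cdf (x : R) : R := fine (normal_prob 0 1 `]-oo, x]).

Definition zero_prob (l0 l1 : R) (y : nat) : R :=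
  std_normal_cdf (l0 + l1 * (ln y.+1%:R / ln 2)).

(* The law of X, mixing over theta ~ N(eta, sigma2) and then over
   Y ~ Poisson(s e^theta).  [normal_prob] takes the standard deviation, and the
   last argument of [poisson_prob] is not used by its definition. *)
Definition zipln (l0 l1 s eta sigma2 : R) (B : set nat) : \bar R :=
  (\int[normal_prob eta (Num.sqrt sigma2)]_theta
     \int[poisson_prob (s * expR theta) 0%N]_y
       ((zero_prob l0 l1 y)%:E * \d_0%N B
        + (1 - zero_prob l0 l1 y)%:E * \d_y B))%E.

End zipln.

Section model.
Context (R : realType).

Definition borel_space (D : nat) : measurableType _ :=
  g_sigma_algebraType (@open 'rV[R]_D).

(* The prior of the parameters other than G_0 and nu, gamma: a probability on a
   space of parameters (including hyperparameters), on which alpha, H, etc. are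
   functions. *)
Record prior (D : nat) := Prior {
  par_display : measure_display;
  par_space : measurableType par_display;
  par_law : probability par_space R;
  alpha : {mfun par_space >-> R};
  alpha_gt0 : forall t, 0 < alpha t;
  base : {mfun par_space >-> pprobability (borel_space D) R};
  base_nonatomic : forall t (x : borel_space D),
    (base t : probability (borel_space D) R) [set x] = 0%E;
  lambda0 : 'I_D -> {mfun par_space >-> R};
  lambda1 : 'I_D -> {mfun par_space >-> R};
  lambda1_lt0 : forall g t, lambda1 g t < 0;
  sigma2 : 'I_D -> {mfun par_space >-> R};
  sigma2_gt0 : forall g t, 0 < sigma2 g t;
  beta : 'I_D -> nat -> {mfun par_space >-> R};
  beta_ref : forall g t, beta g 0%N t = 0 }.

(* (j, i): the i-th cell of subject j *)
Definition cell (m : nat) (n : 'I_m -> nat) : finType := {j : 'I_m & 'I_(n j)}.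

Definition data (m : nat) (n : 'I_m -> nat) (D : nat) : choiceType :=
  {ffun cell n * 'I_D -> nat}.

(* A realization of the SCSC model on some probability space, the G^(j) being
   i.i.d. from DP(nu, DP(gamma, G_0)), truncated at levels L and K respectively.
   Writing G^*_l for [sub_measure l] and S^(j) for [sub_label j], the random
   measure G^(j) is G^*_(S^(j)).  Each layer is specified by its conditional law
   given all the previous ones. *)
Record scsc_model (m : nat) (n : 'I_m -> nat) (D : nat) (nu gamma : R)
    (s : cell n -> R) (pr : prior D) (L K : option nat) := ScscModel {
  omega_display : measure_display;
  sample_space : measurableType omega_display;
  sample_law : probability sample_space R;

  par : {mfun sample_space >-> par_space pr};
  G0 : {mfun sample_space >-> pprobability (borel_space D) R};
  sub_stick : nat -> {mfun sample_space >-> R};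
  sub_weight := fun (l : nat) (w : sample_space) =>
    gem_weight L (sub_stick ^~ w) l;
  sub_measure : nat -> {mfun sample_space >-> pprobability (borel_space D) R};
  sub_label : 'I_m -> {mfun sample_space >-> nat};
  cell_effect : cell n -> {mfun sample_space >-> borel_space D};
  count_data : cell n * 'I_D -> {mfun sample_space >-> nat};

  hist1 := events_of1 par;
  hist2 := hist1 `|` events_of1 G0;
  hist3 := hist2 `|` events_of (stick_index L) sub_stick;
  hist4 := hist3 `|` events_of (atom_index L) sub_measure;
  hist5 := hist4 `|` events_of setT sub_label;
  hist6 := hist5 `|` events_of setT cell_effect;

  par_spec : forall A, measurable A -> sample_law (par @^-1` A) = par_law pr A;
  G0_spec : exists2 DP0 :
      {mfun par_space pr >-> pprobability (pprobability (borel_space D) R) R},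
    (forall t, is_DP None (alpha pr t) (base pr t) (DP0 t)) &
    cond_law sample_law hist1 G0 (fun w => DP0 (par w) : probability _ R);
  sub_stick_spec :
    cond_indep_laws sample_law hist2 (stick_index L) sub_stick
      (fun _ _ => beta_law 1 nu);
  sub_measure_spec : exists2 DPK :
      {mfun pprobability (borel_space D) R >->
            pprobability (pprobability (borel_space D) R) R},
    (forall G, is_DP K gamma G (DPK G)) &
    cond_indep_laws sample_law hist3 (atom_index L) sub_measure
      (fun _ w => DPK (G0 w) : probability _ R);
  sub_label_spec :
    cond_indep_laws sample_law hist4 setT sub_label
      (fun _ w => discrete_measure (sub_weight ^~ w) id);
  cell_effect_spec :
    cond_indep_laws sample_law hist5 setT cell_effect
      (fun c w => sub_measure (sub_label (tag c) w) w : probability _ R);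
  count_data_spec :
    cond_indep_laws sample_law hist6 setT count_data
      (fun cg w => let: (c, g) := cg in
        zipln (lambda0 pr g (par w)) (lambda1 pr g (par w)) (s c)
          ((cell_effect c w : 'rV[R]_D) ord0 g
             + beta pr g (sub_label (tag c) w) (par w))
          (sigma2 pr g (par w))) }.

Definition marginal (m : nat) (n : 'I_m -> nat) (D : nat) (nu gamma : R)
    (s : cell n -> R) (pr : prior D) (L K : option nat)
    (M : scsc_model nu gamma s pr L K) (x : data n D) : R :=
  fine (sample_law M [set w | forall cg, count_data M cg w = x cg]).

End model.

(* Main.v *)
(** Both marginals dominate the function [minorant]: the part of the mass of x
    carried by the configurations in which every subject gets one of the first
    L-1 subgroups and every cell one of the first K-1 atoms of its subgroup.  On
    these configurations truncated and untruncated sticks coincide.  The atoms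
    are i.i.d. from G_0, so the retained mass is a polynomial in integrals
    against G_0, with stick-breaking moments as coefficients; it is the same in
    both models because the moments int prod_b G(f_b) DP(dG) are determined by
    the stick-breaking representation.

    The total mass of [minorant] is bounded below through terms E[W^r], with W the total
    weight of the first N sticks.  Since E[W] = 1 - (a/(a+1))^N, convexity gives
    E[W^r] >= (1 - (a/(a+1))^N)^r, and altogether the mass is at least the
    product B of the right-hand side.  Finally |p - p'| = p + p' - 2 min(p, p')
    gives sum |p - p'| <= 2 - 2 B. *)

Require Import Defs.
From mathcomp Require Import all_boot all_order all_algebra finmap.
From mathcomp Require Import all_classical all_reals all_analysis.
From mathcomp Require Import measurable_realfun ring lra.
Set Implicit Arguments.
Unset Strict Implicit.
Unset Printing Implicit Defensive.
Import Order.TTheory GRing.Theory Num.Theory.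
Import numFieldNormedType.Exports.
Local Open Scope classical_set_scope.
Local Open Scope ring_scope.

(** * Extensionality of integral-like functionals *)

(** The two models live on unrelated probability spaces, and each Dirichlet process kernel is known
    only through the existence of some stick-breaking representation. No coupling is constructed;
    the comparison goes through expectations of products of integrals alone. Since every layer is
    specified by conditional probabilities of events, these are first upgraded to a rule for
    integrating out one layer: counts, cell effects, labels, then subgroup measures together with
    their sticks, until only the parameters and G_0 remain.

    A minorant needs only one-sided estimates at the truncated layers, where discarded
    configurations contribute nonnegative mass. Exact agreement is required only at the layer of
    G_0, which is not truncated; there the partial moments converge to the full moment, which is
    therefore determined.

    The exponents L - 1 and K - 1 arise because the last weight of a truncated process is the
    remaining mass and not a stick product. There is one label per subject and one atom per cell,
    whence the powers m and n_1 + ... + n_m. *)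

Section integral_functionals.
Local Open Scope ereal_scope.
Context (d : measure_display) (X : measurableType d) (R : realType).
Implicit Types Phi Psi : (X -> \bar R) -> \bar R.

(* The properties of [f |-> \int f] that let the class of sets on which two such
   functionals agree be a lambda-system; their sums, iterated integrals and
   conditional expectations all qualify. *)
Record integral_like Phi : Prop := IntegralLike {
  il_ge0 : forall f : X -> \bar R,
    measurable_fun setT f -> (forall x, 0 <= f x) -> 0 <= Phi f;
  il_add : forall f g : X -> \bar R, measurable_fun setT f -> measurable_fun setT g ->
    (forall x, 0 <= f x) -> (forall x, 0 <= g x) ->
    Phi (f \+ g) = Phi f + Phi g;
  il_le : forall f g : X -> \bar R, measurable_fun setT f -> measurable_fun setT g ->
    (forall x, 0 <= f x) -> (forall x, f x <= g x) -> Phi f <= Phi g;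
  il_scale : forall (r : R) (f : X -> \bar R), (0 <= r)%R -> measurable_fun setT f ->
    (forall x, 0 <= f x) -> Phi (fun x => r%:E * f x) = r%:E * Phi f;
  il_lim : forall (f : (X -> \bar R)^nat), (forall n, measurable_fun setT (f n)) ->
    (forall n x, 0 <= f n x) -> (forall x, nondecreasing_seq (f^~ x)) ->
    Phi (fun x => limn (f^~ x)) = limn (fun n => Phi (f n)) }.

Lemma il0 Phi : integral_like Phi -> Phi (fun=> 0) = 0.
Proof.
move=> H; have := @il_scale _ H 0%R (fun=> 0) (lexx _) (@measurable_cst _ _ _ _ _ _) (fun=> lexx _).
by under eq_fun do rewrite mule0; rewrite mul0e.
Qed.

Lemma il_sum Phi (I : eqType) (s : seq I) (f : I -> X -> \bar R) : integral_like Phi ->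
  (forall i, i \in s -> measurable_fun setT (f i)) ->
  (forall i x, i \in s -> 0 <= f i x) ->
  Phi (fun x => \sum_(i <- s) f i x) = \sum_(i <- s) Phi (f i).
Proof.
move=> H; elim: s => [|i s IH] mf f0.
  by rewrite big_nil; under eq_fun do rewrite big_nil; exact: il0.
rewrite big_cons -IH; last 2 first.
  by move=> j js; apply: mf; rewrite in_cons js orbT.
  by move=> j x js; apply: f0; rewrite in_cons js orbT.
rewrite -(il_add H) //.
- by congr Phi; apply/funext => x; rewrite big_cons.
- by apply: mf; rewrite mem_head.
- have -> : (fun x => \sum_(j <- s) f j x) = (fun x => \sum_(j <- s | j \in s) f j x).
    by apply/funext => x; rewrite -big_seq.
  pose f' j := if j \in s then f j else (fun=> 0).
  have -> : (fun x => \sum_(j <- s | j \in s) f j x) = (fun x => \sum_(j <- s) f' j x).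
    apply/funext => x; rewrite big_mkcond; apply: eq_bigr => j _.
    by rewrite /f'; case: ifP.
  apply: emeasurable_sum => j; rewrite /f'; case: ifPn => // js.
  by apply: mf; rewrite in_cons js orbT.
- by move=> x; apply: f0; rewrite mem_head.
- by move=> x; rewrite big_seq; apply: sume_ge0 => j js; apply: f0; rewrite in_cons js orbT.
Qed.

Let ind (A : set X) : X -> \bar R := fun x => (\1_A x)%:E.

Let mind A : measurable A -> measurable_fun setT (ind A).
Proof. by move=> mA; apply/measurable_EFinP; exact: measurable_indic. Qed.

Let ind0 A x : 0 <= ind A x.
Proof. by rewrite lee_fin. Qed.

Import HBNNSimple.

(** A lambda-system argument carries equality from [G] to all measurable sets, and monotone
    approximation by simple functions carries it on to functions. Finiteness of [Phi] at 1 is what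
    allows proper differences of sets to be subtracted. *)
Lemma integral_like_ext Phi Psi (G : set (set X)) :
  integral_like Phi -> integral_like Psi ->
  measurable = <<s G >> -> setI_closed G ->
  (forall A, G A -> Phi (fun x => (\1_A x)%:E) = Psi (fun x => (\1_A x)%:E)) ->
  Phi (fun=> 1) = Psi (fun=> 1) -> Phi (fun=> 1) < +oo ->
  forall f, measurable_fun setT f -> (forall x, 0 <= f x) -> Phi f = Psi f.
Proof.
move=> HPhi HPsi mG IG eqG eq1 fin1.
have indT : ind setT = (fun=> 1) by apply/funext => x; rewrite /ind indicT.
have fin (K : (X -> \bar R) -> \bar R) A : integral_like K -> K (fun=> 1) < +oo ->
    measurable A -> K (ind A) \is a fin_num.
  move=> HK K1 mA; rewrite ge0_fin_numE; last by apply: (il_ge0 HK) => //; exact: mind.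
  apply: le_lt_trans K1; rewrite -indT; apply: (il_le HK) => //; [exact: mind|exact: mind|].
  by move=> x; rewrite lee_fin indicT /=; rewrite indicE; case: (_ \in _).
pose D := [set A | measurable A /\ Phi (ind A) = Psi (ind A)].
have DE : D = measurable.
  apply/seteqP; split => [A []//|]; rewrite mG.
  apply: lambda_system_subset => //.
  2:{ by move=> A GA; split; [rewrite mG; exact: sub_sigma_algebra|exact: eqG]. }
  split => //.
  - by split => //; rewrite indT.
  - move=> A B BA [mA eA] [mB eB]; split; first exact: measurableD.
    have H K : integral_like K -> K (fun=> 1) < +oo -> K (ind (A `\` B)) = K (ind A) - K (ind B).
      move=> HK K1.
      have -> : ind A = ind (A `\` B) \+ ind B.
        apply/funext => x; rewrite /ind /= -EFinD; congr EFin.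
        rewrite !indicE in_setD; have [xB|xB] := boolP (x \in B); last by rewrite andbT addr0.
        by rewrite andbF add0r mem_set//; apply: BA; exact/set_mem.
      rewrite (il_add HK) //; [|exact/mind/measurableD|exact: mind].
      by rewrite addeK// fin.
    by rewrite !H// ?eA ?eB// -eq1.
  - move=> F ndF DF; have mF n : measurable (F n) by case: (DF n).
    split; first exact: bigcup_measurable.
    (* Written as a limit of indicators, the increasing union falls under [il_lim]. *)
    have indU : ind (\bigcup_n F n) = fun x => limn (fun n => ind (F n) x).
      apply/funext => x; apply/esym/cvg_lim => //.
      have [[n _ Fnx]|nFx] := pselect ((\bigcup_n F n) x).
        apply: cvg_near_cst; exists n => // k /= nk.
        rewrite /ind !indicE !mem_set//; [by exists n|].
        by move: (ndF _ _ nk) => /subsetPset; exact.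
      apply: cvg_near_cst; apply: nearW => k.
      rewrite /ind !indicE !memNset// => Fkx; apply: nFx; by exists k.
    have ndind x : nondecreasing_seq (fun n => ind (F n) x).
      move=> a b ab; rewrite lee_fin !indicE.
      have [Fa|] := boolP (x \in F a) => //.
      rewrite mem_set//; move: (ndF _ _ ab) => /subsetPset; apply; exact/set_mem.
    rewrite indU !(il_lim _ (f := fun n => ind (F n))) //; [|by move=> n; exact: mind..].
    by congr (limn _); apply/funext => n; case: (DF n).
have eqind A : measurable A -> Phi (ind A) = Psi (ind A) by rewrite -DE => -[].
move=> f mf f0; pose f_ := nnsfun_approx measurableT mf.
have fE : f = fun x => limn (fun n => (f_ n x)%:E).
  by apply/funext => x; apply/esym/cvg_lim => //; exact: cvg_nnsfun_approx.
have mf_ n : measurable_fun setT (EFin \o f_ n) by apply/measurable_EFinP.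
have f_0 n x : 0 <= (EFin \o f_ n) x by rewrite lee_fin.
have ndf_ x : nondecreasing_seq (fun n => (EFin \o f_ n) x).
  by move=> a b ab; rewrite lee_fin; exact/lefP/nd_nnsfun_approx.
have E n K : integral_like K -> K (EFin \o f_ n) =
    \sum_(r <- fset_set (range (f_ n))) r%:E * K (ind (f_ n @^-1` [set r])).
  move=> HK.
  have sr r : r \in fset_set (range (f_ n)) -> (0 <= r)%R.
    by rewrite in_fset_set; [move/set_mem => -[x _ <-]|exact/fimfunP].
  have -> : EFin \o f_ n = fun x =>
      \sum_(r <- fset_set (range (f_ n))) r%:E * ind (f_ n @^-1` [set r]) x.
    apply/funext => x; rewrite /ind /=.
    under eq_bigr do rewrite -EFinM.
    rewrite sumEFin; congr EFin.
    by rewrite [LHS](fimfunE (f_ n)) fsbig_finite //=; exact/fimfunP.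
  rewrite (il_sum HK); first last.
  - by move=> r x /sr r0; rewrite mule_ge0.
  - by move=> r _; apply: measurable_funeM; exact: mind.
  rewrite big_seq [RHS]big_seq; apply: eq_bigr => r /sr r0.
  by rewrite (il_scale HK)//; exact: mind.
rewrite fE (il_lim HPhi (f := fun n => EFin \o f_ n))// (il_lim HPsi (f := fun n => EFin \o f_ n))//.
congr (limn _); apply/funext => n; rewrite !E//.
by apply: eq_bigr => r _; rewrite eqind.
Qed.

End integral_functionals.

Section integral_functional_instances.
Local Open Scope ereal_scope.
Context (d : measure_display) (X : measurableType d) (R : realType).

Lemma il_eval (x : X) : integral_like (fun g : X -> \bar R => g x).
Proof. by split. Qed.

Lemma il_mull (c : \bar R) Phi : c \is a fin_num -> 0 <= c ->
  integral_like Phi -> integral_like (fun g : X -> \bar R => c * Phi g).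
Proof.
move=> cfin c0 H; split.
- by move=> f mf f0; rewrite mule_ge0// (il_ge0 H).
- move=> f g mf mg f0 g0; rewrite (il_add H)// ge0_muleDr//; exact: (il_ge0 H).
- by move=> f g mf mg f0 fg; rewrite lee_wpmul2l// (il_le H).
- by move=> r f r0 mf f0; rewrite (il_scale H)// muleCA.
- move=> f mf f0 ndf; rewrite (il_lim H)// limeMl//.
  apply: ereal_nondecreasing_is_cvgn => a b ab.
  by apply: (il_le H) => // x; exact: ndf.
Qed.

Lemma il_integral d' (T : measurableType d') (mu : {measure set T -> \bar R})
    (Phi : T -> (X -> \bar R) -> \bar R) :
  (forall w, integral_like (Phi w)) ->
  (forall g : X -> \bar R, measurable_fun setT g -> (forall x, 0 <= g x) ->
    measurable_fun setT (fun w => Phi w g)) ->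
  integral_like (fun g => \int[mu]_w Phi w g).
Proof.
move=> H mPhi; split.
- by move=> f mf f0; apply: integral_ge0 => w _; exact: (il_ge0 (H w)).
- move=> f g mf mg f0 g0; rewrite -ge0_integralD//=.
  + by apply: eq_integral => w _; exact: (il_add (H w)).
  + by move=> w _; exact: (il_ge0 (H w)).
  + exact: mPhi.
  + by move=> w _; exact: (il_ge0 (H w)).
  + exact: mPhi.
- move=> f g mf mg f0 fg.
  have g0 x : 0 <= g x by apply: le_trans (fg x).
  apply: ge0_le_integral => //.
  + by move=> w _; exact: (il_ge0 (H w)).
  + exact: mPhi.
  + exact: mPhi.
  + by move=> w _; exact: (il_le (H w)).
- move=> r f r0 mf f0; rewrite -ge0_integralZl_EFin//.
  + by apply: eq_integral => w _; exact: (il_scale (H w)).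
  + by move=> w _; exact: (il_ge0 (H w)).
  + exact: mPhi.
- move=> f mf f0 ndf; rewrite -monotone_convergence//.
  + by apply: eq_integral => w _; exact: (il_lim (H w)).
  + by move=> n; exact: mPhi.
  + by move=> n w _; exact: (il_ge0 (H w)).
  + by move=> w _ a b ab; apply: (il_le (H w)) => // x; exact: ndf.
Qed.

Lemma il_measure (mu : {measure set X -> \bar R}) :
  integral_like (fun g : X -> \bar R => \int[mu]_x g x).
Proof. by apply: il_integral => //; exact: il_eval. Qed.

Lemma il_comp d' (T : measurableType d') (phi : T -> X) (Phi : (T -> \bar R) -> \bar R) :
  measurable_fun setT phi -> integral_like Phi ->
  integral_like (fun g : X -> \bar R => Phi (g \o phi)).
Proof.
move=> mphi H; split.
- by move=> f mf f0; apply: (il_ge0 H) => [|x]; [exact: measurableT_comp|exact: f0].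
- move=> f g mf mg f0 g0.
  by apply: (il_add H) => [| |x|x]; [exact: measurableT_comp..|exact: f0|exact: g0].
- move=> f g mf mg f0 fg.
  by apply: (il_le H) => [| |x|x]; [exact: measurableT_comp..|exact: f0|exact: fg].
- move=> r f r0 mf f0.
  by apply: (il_scale H (f := f \o phi)) => // [|x]; [exact: measurableT_comp|exact: f0].
- move=> f mf f0 ndf.
  apply: (il_lim H (f := fun n => f n \o phi)) => [n|n x|x].
  + exact: measurableT_comp.
  + exact: f0.
  + exact: ndf.
Qed.

End integral_functional_instances.

(** * Products and integrals of extended reals in [0,1] *)

Section prode01.
Local Open Scope ereal_scope.
Context (R : realType).

Lemma prode_ge0 I (s : seq I) (P : pred I) (f : I -> \bar R) :
  (forall i, P i -> 0 <= f i) -> 0 <= \prod_(i <- s | P i) f i.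
Proof. by move=> f0; elim/big_ind : _ => // x y; exact: mule_ge0. Qed.

Lemma mule_le1 (x y : \bar R) : 0 <= x <= 1 -> 0 <= y <= 1 -> 0 <= x * y <= 1.
Proof.
move=> /andP[x0 x1] /andP[y0 y1]; rewrite mule_ge0//=.
by rewrite -[leRHS]mule1 lee_pmul.
Qed.

Lemma prode_01 I (s : seq I) (P : pred I) (f : I -> \bar R) :
  (forall i, P i -> 0 <= f i <= 1) -> 0 <= \prod_(i <- s | P i) f i <= 1.
Proof.
move=> f01; elim/big_ind : _ => //; first by rewrite lee01 lexx.
exact: mule_le1.
Qed.

Lemma prode_le I (s : seq I) (P : pred I) (f g : I -> \bar R) :
  (forall i, P i -> 0 <= f i <= g i) -> \prod_(i <- s | P i) f i <= \prod_(i <- s | P i) g i.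
Proof.
move=> fg; suff: 0 <= \prod_(i <- s | P i) f i <= \prod_(i <- s | P i) g i by case/andP.
elim/big_ind2 : _ => //; first by rewrite lee01 lexx.
move=> x1 x2 y1 y2 /andP[x0 x12] /andP[y0 y12].
by rewrite mule_ge0//= lee_pmul.
Qed.

Lemma fin_num01 (x : \bar R) : 0 <= x <= 1 -> x \is a fin_num.
Proof.
by move=> /andP[x0 x1]; rewrite ge0_fin_numE// (le_lt_trans x1)// ltry.
Qed.

Lemma emeasurable_prod d (T : measurableType d) (D : set T) I (s : seq I) (P : pred I)
    (f : I -> T -> \bar R) : (forall i, P i -> measurable_fun D (f i)) ->
  measurable_fun D (fun x => \prod_(i <- s | P i) f i x).
Proof.
move=> mf; elim: s => [|i s IH].
  by under eq_fun do rewrite big_nil; exact: measurable_cst.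
have [Pi|Pi] := boolP (P i); under eq_fun do rewrite big_cons ?Pi ?(negbTE Pi)//.
  by apply: emeasurable_funM => //; exact: mf.
exact: IH.
Qed.

Lemma prode_indic T I (s : seq I) (F : I -> set T) (x : T) :
  \prod_(i <- s) (\1_(F i) x : R)%:E = (\1_(\big[setI/setT]_(i <- s) F i) x)%:E.
Proof.
elim: s => [|i s IH]; first by rewrite !big_nil indicT.
by rewrite !big_cons IH -EFinM indicI.
Qed.

Lemma indic01 T (A : set T) x : 0 <= (\1_A x : R)%:E <= 1.
Proof. by rewrite !lee_fin indicE; case: (_ \in _); rewrite lexx ler01. Qed.

Lemma integral01 d (T : measurableType d) (P : probability T R) (f : T -> \bar R) :
  measurable_fun setT f -> (forall x, 0 <= f x <= 1) -> 0 <= \int[P]_x f x <= 1.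
Proof.
move=> mf f01; apply/andP; split.
  by apply: integral_ge0 => x _; case/andP : (f01 x).
rewrite -(probability_setT P) -[leRHS]mul1e -integral_cst//.
apply: ge0_le_integral => //; last by move=> x _; case/andP : (f01 x).
by move=> x _; case/andP : (f01 x).
Qed.

Lemma integral_prob_cst d (T : measurableType d) (P : probability T R) (r : \bar R) :
  \int[P]_x r = r.
Proof. by rewrite integral_cst// -[RHS]mule1; congr (_ * _); exact: probability_setT. Qed.

End prode01.

(** * Measurability with respect to generated sub-sigma-algebras *)

Section measurable_sub.
Context (R : realType) (d : measure_display) (Omega : measurableType d).

Lemma measurable_fun_sub (H : set (set Omega)) d' (T : measurableType d')
  (f : Omega -> T) : H `<=` measurable ->
  measurable_fun [set: g_sigma_algebraType H] f -> measurable_fun [set: Omega] f.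
Proof.
move=> HM mf _ B mB; have := mf measurableT B mB; rewrite !setTI => ?.
have : <<s H >> `<=` @measurable _ Omega; last by apply.
by apply: smallest_sub => //; exact: sigma_algebra_measurable.
Qed.

Lemma measurable_fun_sigmaS (H H' : set (set Omega)) d' (T : measurableType d')
  (f : Omega -> T) : H `<=` H' -> measurable_fun [set: g_sigma_algebraType H] f ->
  measurable_fun [set: g_sigma_algebraType H'] f.
Proof.
move=> HH' mf _ B mB; have := mf measurableT B mB; rewrite !setTI.
have : <<s H >> `<=` <<s H' >>; last exact.
apply: smallest_sub; first exact: smallest_sigma_algebra.
by apply: (subset_trans HH'); exact: sub_gen_smallest.
Qed.

Lemma measurable_fun_events (H : set (set Omega)) d' (T : measurableType d')
  (f : Omega -> T) : preimage_set_system setT f measurable `<=` H ->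
  measurable_fun [set: g_sigma_algebraType H] f.
Proof.
move=> fH _ B mB; apply: sub_sigma_algebra; apply: fH.
by exists B.
Qed.

Lemma events_of_measurable I d' (T : measurableType d') (D : set I) (W : I -> Omega -> T) :
  (forall i, measurable_fun setT (W i)) -> events_of D W `<=` measurable.
Proof. by move=> mW A [i _ [B mB <-]]; exact: mW. Qed.

Lemma events_of1_measurable d' (T : measurableType d') (W : Omega -> T) :
  measurable_fun setT W -> events_of1 W `<=` measurable.
Proof. by move=> mW A [B mB <-]; exact: mW. Qed.

End measurable_sub.

(** * Integrating conditionally independent variables *)

Section conditional_independence.
Local Open Scope ereal_scope.
Context (R : realType) (d : measure_display) (Omega : measurableType d).
Variables (P : probability Omega R) (H : set (set Omega)).
Hypothesis HM : H `<=` measurable.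
Context (I : choiceType) (dT : measure_display) (T : measurableType dT).
Variables (D : set I) (W : I -> Omega -> T).
Hypothesis mW : forall i, measurable_fun setT (W i).
Variable kappa : I -> Omega -> set T -> \bar R.
Hypothesis Wkappa : cond_indep_laws P H D W kappa.

Let sHM : <<s H >> `<=` measurable.
Proof. by apply: smallest_sub => //; exact: sigma_algebra_measurable. Qed.

Lemma cond_indep_laws_seq (A : set Omega) (s : seq I) (B : I -> set T) :
  <<s H >> A -> uniq s -> [set` s] `<=` D -> (forall i, measurable (B i)) ->
  P (A `&` \bigcap_(i in [set` s]) (W i @^-1` B i)) =
  \int[P]_(w in A) \prod_(i <- s) kappa i w (B i).
Proof.
move=> HA us sD mB.
have Es : perm_eq [fset x | x in s]%fset s.
  by apply: uniq_perm => //= x; rewrite !inE.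
have Es' : [set` [fset x | x in s]%fset] = [set` s].
  by apply/seteqP; split => x /=; rewrite !inE.
rewrite -Es' Wkappa// ?Es'//.
by apply: eq_integral => w _; exact: perm_big.
Qed.

(* [kappa] need only agree almost surely with a [0,1]-valued [h]: the law of the
   labels is given by stick-breaking weights, which may be negative on a null set. *)
Lemma cond_indep_sets (Z : Omega -> \bar R) (s : seq I) (B : I -> set T)
    (h : Omega -> \bar R) :
  measurable_fun [set: g_sigma_algebraType H] Z -> (forall w, 0 <= Z w) ->
  uniq s -> [set` s] `<=` D -> (forall i, measurable (B i)) ->
  (forall w, 0 <= h w <= 1) -> measurable_fun setT h ->
  (forall i, i \in s -> measurable_fun setT (fun w => kappa i w (B i))) ->
  {ae P, forall w, \prod_(i <- s) kappa i w (B i) = h w} ->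
  \int[P]_w (\prod_(i <- s) (\1_(W i @^-1` B i) w)%:E * Z w) = \int[P]_w (h w * Z w).
Proof.
move=> mZ Z0 us sD mB h01 mh mk aeh.
have c01 w : 0 <= \prod_(i <- s) (\1_(W i @^-1` B i) w : R)%:E <= 1.
  by apply: prode_01 => i _; exact: indic01.
have mWB i : measurable (W i @^-1` B i).
  by rewrite -[X in measurable X]setTI; exact: mW.
have mc : measurable_fun setT (fun w => \prod_(i <- s) (\1_(W i @^-1` B i) w : R)%:E).
  by apply: emeasurable_prod => i _; apply/measurable_EFinP; exact: measurable_indic.
have il (c : Omega -> \bar R) : (forall w, 0 <= c w <= 1) -> measurable_fun setT c ->
   integral_like (fun g : g_sigma_algebraType H -> \bar R => \int[P]_w (c w * g w)).
  move=> H01 mc'; apply: il_integral => [w|g mg g0].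
    apply: (@il_mull _ (g_sigma_algebraType H) R (c w) (fun g => g w)).
    - exact: fin_num01.
    - by case/andP : (H01 w).
    - exact: il_eval.
  by apply: emeasurable_funM => //; exact: (measurable_fun_sub HM).
(* For [Z] the indicator of an event of the conditioning sigma-algebra, the claim is the defining
   property of [cond_indep_laws], with [h] replacing the product of kernels almost everywhere. *)
have eqA A : <<s H >> A ->
    \int[P]_w (\prod_(i <- s) (\1_(W i @^-1` B i) w)%:E * (\1_A w)%:E) =
    \int[P]_w (h w * (\1_A w)%:E).
  move=> HA; have mA := sHM HA.
  transitivity (P (A `&` \bigcap_(i in [set` s]) (W i @^-1` B i))).
    rewrite bigcap_seq -[X in P X]setIT -integral_indic//=.
      by apply: eq_integral => w _; rewrite prode_indic -EFinM indicI mulrC.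
    apply: measurableI => //.
    by elim/big_ind : _ => // *; exact: measurableI.
  rewrite cond_indep_laws_seq//.
  transitivity (\int[P]_(w in A) h w).
    apply: ae_eq_integral => //.
    - apply: (measurable_funS measurableT) => //.
      under eq_fun do rewrite big_seq; exact: emeasurable_prod.
    - exact: (measurable_funS measurableT).
    - by move: aeh; apply: filterS => w /= ->.
  rewrite integral_mkcond; apply: eq_integral => w _.
  by rewrite epatch_indic.
(* Regarded as functionals of functions on [g_sigma_algebraType H], both sides extend from events to
   every nonnegative [Z] measurable for [H]; the generating family is the whole sigma-algebra. *)
apply: (@integral_like_ext _ (g_sigma_algebraType H) R
  (fun g => \int[P]_w (\prod_(i <- s) (\1_(W i @^-1` B i) w)%:E * g w))
  (fun g => \int[P]_w (h w * g w)) measurable) => //.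
- exact: il.
- exact: il.
- by rewrite sigma_algebra_id//; exact: sigma_algebra_measurable.
- by move=> A B' mA mB'; exact: measurableI.
- have := eqA setT (@measurableT _ (g_sigma_algebraType H)).
  by under eq_integral do rewrite indicT; under [RHS]eq_integral do rewrite indicT.
- apply: le_lt_trans (ltry 1%R); under eq_integral do rewrite mule1.
  by case/andP : (integral01 P mc c01).
Qed.

Variable K : I -> Omega -> pprobability T R.
Hypothesis mK : forall i, measurable_fun setT (K i).
Hypothesis kappaK : forall i w B, D i -> measurable B ->
  kappa i w B = (K i w : probability T R) B.

Lemma measurable_fun_kernel_integral d1 (S : measurableType d1) (Q : Omega -> pprobability T R)
    (V : Omega -> S) (g : S * T -> \bar R) :
  measurable_fun setT Q -> measurable_fun setT V ->
  measurable_fun setT g -> (forall x, 0 <= g x) ->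
  measurable_fun setT (fun w => \int[Q w : probability T R]_y g (V w, y)).
Proof.
move=> mQ mV mg g0.
apply: (measurable_fun_integral_finite_kernel (fun z => g (V z.1, z.2)) (kprobability mQ)) => //.
apply: (measurableT_comp mg).
by apply: measurable_fun_pair => //; exact: measurableT_comp.
Qed.

Let measurable_kernel_set i B : measurable B ->
  measurable_fun setT (fun w => (K i w : probability T R) B).
Proof. by move=> mB; exact: (measurable_kernel (kprobability (mK i))). Qed.

(** The rule for integrating out a layer: what is known given [H] (here [U] and [Z]) is frozen, and
    each [W i] is averaged under its own kernel. Every later elimination of counts' parents, atoms,
    sticks or G_0 is an instance. *)
Lemma cond_indep_integral d1 (S : measurableType d1) (U : Omega -> S)
    (Z : Omega -> \bar R) (s : seq I) (g : I -> S * T -> \bar R) :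
  measurable_fun [set: g_sigma_algebraType H] U ->
  measurable_fun [set: g_sigma_algebraType H] Z -> (forall w, 0 <= Z w <= 1) ->
  uniq s -> [set` s] `<=` D ->
  (forall i, measurable_fun setT (g i)) -> (forall i z, 0 <= g i z <= 1) ->
  \int[P]_w (Z w * \prod_(i <- s) g i (U w, W i w)) =
  \int[P]_w (Z w * \prod_(i <- s) \int[K i w : probability T R]_y g i (U w, y)).
Proof.
move=> mU mZ Z01 us sD.
have mU' := measurable_fun_sub HM mU.
have mZ' := measurable_fun_sub HM mZ.
(* [t] lists the indices whose integrand may be arbitrary; all others carry indicators of
   rectangles. Induction on [t] frees one index at a time. *)
suff main (t : seq I) : forall g : I -> S * T -> \bar R,
    (forall i, i \notin t -> exists (A : set S) (B : set T), [/\ measurable A, measurable B &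
       forall z, g i z = (\1_(A `*` B) z)%:E]) ->
    (forall i, measurable_fun setT (g i)) -> (forall i z, 0 <= g i z <= 1) ->
    \int[P]_w (Z w * \prod_(i <- s) g i (U w, W i w)) =
    \int[P]_w (Z w * \prod_(i <- s) \int[K i w : probability T R]_y g i (U w, y)).
  move=> mg g01.
  (* Indices outside [s] do not occur in the products, so they may be given the constant 1, the
     indicator of the full rectangle. *)
  pose g' i := if i \in s then g i else (fun=> 1).
  have := main s g'.
  rewrite [X in _ -> _ -> _ -> X = _](_ : _ = \int[P]_w (Z w * \prod_(i <- s) g i (U w, W i w))).
    rewrite [X in _ -> _ -> _ -> _ = X](_ : _ = \int[P]_w (Z w * \prod_(i <- s) \int[K i w : probability T R]_y g i (U w, y))).
      apply.
      - move=> i /negbTE is_; exists setT, setT; split => // z.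
        by rewrite /g' is_ setXTT indicT.
      - by move=> i; rewrite /g'; case: ifP => // _; exact: mg.
      - by move=> i z; rewrite /g'; case: ifP => // _; rewrite lee01 lexx.
    apply: eq_integral => w _; congr (_ * _).
    by apply: eq_big_seq => i is_; rewrite /g' is_.
  apply: eq_integral => w _; congr (_ * _).
  by apply: eq_big_seq => i is_; rewrite /g' is_.
elim: t => [|i0 t IH] g0 rect mg g01.
  (* With rectangles only, the factors in [U] are absorbed into the weight [Z'], and those in [W]
     are handled by [cond_indep_sets]. *)
  have /(_ _)/cid-/all_sig[A /(_ _)/cid-/all_sig[B AB]] := fun i => rect i isT.
  have mA i : measurable (A i) by case: (AB i).
  have mB i : measurable (B i) by case: (AB i).
  have gE i z : g0 i z = (\1_(A i) z.1)%:E * (\1_(B i) z.2)%:E.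
    by case: (AB i) => _ _ ->; rewrite -EFinM !indicE in_setX; case: (_ \in _); rewrite /= ?mul1r ?mul0r.
  pose Z' w := Z w * \prod_(i <- s) (\1_(A i) (U w))%:E.
  pose h w := \prod_(i <- s) (K i w : probability T R) (B i).
  have K01 i w : 0 <= (K i w : probability T R) (B i) <= 1.
    by rewrite measure_ge0 probability_le1.
  have Z'01 w : 0 <= Z' w <= 1.
    by apply: mule_le1 => //; apply: prode_01 => i _; exact: indic01.
  have mZ'' : measurable_fun [set: g_sigma_algebraType H] Z'.
    apply: emeasurable_funM => //; apply: emeasurable_prod => i _.
    apply/measurable_EFinP.
    by apply: (measurableT_comp (@measurable_indic _ _ R _ _ (mA i)) mU).
  have := @cond_indep_sets Z' s B h mZ'' _ us sD mB (fun w => prode_01 _ (fun i _ => K01 i w)).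
  move=> /(_ (fun w => proj1 (andP (Z'01 w)))).
  move=> /(_ (emeasurable_prod _ (fun i _ => measurable_kernel_set i (mB i)))).
  have kE i : i \in s -> (fun w => kappa i w (B i)) = (fun w => (K i w : probability T R) (B i)).
    by move=> is_; apply/funext => w; rewrite kappaK//; exact: sD.
  move=> H0; transitivity (\int[P]_w (\prod_(i <- s) (\1_(W i @^-1` B i) w)%:E * Z' w)).
    apply: eq_integral => w _; rewrite /Z' muleCA; congr (_ * _).
    by rewrite muleC -big_split/=; apply: eq_bigr => i _; rewrite gE.
  rewrite H0.
  - apply: eq_integral => w _; rewrite /Z' muleCA; congr (_ * _).
    rewrite muleC -big_split/=; apply: eq_bigr => i _.
    under eq_integral do rewrite gE /=.
    rewrite ge0_integralZl_EFin//=.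
    - by rewrite integral_indic// setIT.
    - by apply/measurable_EFinP; exact: measurable_indic.
  - by move=> i is_; rewrite kE//; exact: measurable_kernel_set.
  - apply: nearW => w; apply: eq_big_seq => i is_.
    by rewrite kappaK//; exact: sD.
(* [g1 f] puts [f] at the index being freed. With the other factors collected in a weight, both
   sides are integral-like in [f]; the induction hypothesis covers rectangles, which generate the
   product sigma-algebra. *)
pose g1 (f : S * T -> \bar R) i := if i == i0 then f else g0 i.
have g1rect f A B : measurable A -> measurable B -> f = (fun z => (\1_(A `*` B) z)%:E) ->
    forall i, i \notin t -> exists (A : set S) (B : set T),
       [/\ measurable A, measurable B & forall z, g1 f i z = (\1_(A `*` B) z)%:E].
  move=> mA mB -> i it; rewrite /g1; have [_|ii0] := eqVneq i i0; first by exists A, B.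
  by apply: rect; rewrite in_cons negb_or ii0.
have mg1 f : measurable_fun setT f -> forall i, measurable_fun setT (g1 f i).
  by move=> mf i; rewrite /g1; case: ifP.
have g101 f : (forall z, 0 <= f z <= 1) -> forall i z, 0 <= g1 f i z <= 1.
  by move=> f01 i z; rewrite /g1; case: ifP.
have K01 i w f : measurable_fun setT f -> (forall z, 0 <= f z <= 1) ->
    0 <= \int[K i w : probability T R]_y f (U w, y) <= 1.
  move=> mf f01; apply: integral01 => //.
  by apply: (measurableT_comp mf); exact: measurable_pair1.
have [i0s|i0s] := boolP (i0 \in s); last first.
  have is_ i : i \in s -> i == i0 = false.
    by move=> iS; apply: contraNF i0s => /eqP <-.
  transitivity (\int[P]_w (Z w * \prod_(i <- s) g1 (fun=> 1) i (U w, W i w))).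
    apply: eq_integral => w _; congr (_ * _); apply: eq_big_seq => i /is_.
    by rewrite /g1 => ->.
  rewrite IH.
  - apply: eq_integral => w _; congr (_ * _); apply: eq_big_seq => i /is_.
    by rewrite /g1 => ->.
  - apply: (g1rect _ setT setT) => //.
    by apply/funext => z; rewrite setXTT indicT.
  - exact: mg1.
  - by apply: g101 => z; rewrite lee01 lexx.
have splitL f w : Z w * \prod_(i <- s) g1 f i (U w, W i w) =
    (Z w * \prod_(i <- s | i != i0) g0 i (U w, W i w)) * f (U w, W i0 w).
  rewrite (bigD1_seq i0)//= {1}/g1 eqxx muleCA muleC; congr (_ * _ * _).
  by apply: eq_bigr => i /negbTE; rewrite /g1 => ->.
have splitR f w : Z w * \prod_(i <- s) \int[K i w : probability T R]_y g1 f i (U w, y) =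
    (Z w * \prod_(i <- s | i != i0) \int[K i w : probability T R]_y g0 i (U w, y))
     * \int[K i0 w : probability T R]_y f (U w, y).
  rewrite (bigD1_seq i0)//= {1}/g1 eqxx muleCA muleC; congr (_ * _ * _).
  by apply: eq_bigr => i /negbTE; rewrite /g1 => ->.
pose c w := Z w * \prod_(i <- s | i != i0) g0 i (U w, W i w).
pose c' w := Z w * \prod_(i <- s | i != i0) \int[K i w : probability T R]_y g0 i (U w, y).
have c01 w : 0 <= c w <= 1 by apply: mule_le1 => //; apply: prode_01.
have c'01 w : 0 <= c' w <= 1.
  by apply: mule_le1 => //; apply: prode_01 => i _; exact: K01.
have g0_ge0 i z : 0 <= g0 i z by case/andP : (g01 i z).
have mUW i : measurable_fun setT (fun w => (U w, W i w)).
  by apply: measurable_fun_pair => //; exact: mW.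
have mc : measurable_fun setT c.
  apply: emeasurable_funM => //; apply: emeasurable_prod => i _.
  exact: (measurableT_comp (mg i) (mUW i)).
have mc' : measurable_fun setT c'.
  apply: emeasurable_funM => //; apply: emeasurable_prod => i _.
  exact: measurable_fun_kernel_integral.
have g0E : g1 (g0 i0) = g0.
  by apply/funext => i; rewrite /g1; case: eqP => // ->.
have EL f : \int[P]_w (Z w * \prod_(i <- s) g1 f i (U w, W i w)) =
    \int[P]_w (c w * f (U w, W i0 w)).
  by apply: eq_integral => w _; exact: splitL.
have ER f : \int[P]_w (Z w * \prod_(i <- s) \int[K i w : probability T R]_y g1 f i (U w, y)) =
    \int[P]_w (c' w * \int[K i0 w : probability T R]_y f (U w, y)).
  by apply: eq_integral => w _; exact: splitR.
rewrite -g0E EL ER.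
apply: (@integral_like_ext _ _ R
  (fun f : S * T -> \bar R => \int[P]_w (c w * f (U w, W i0 w)))
  (fun f => \int[P]_w (c' w * \int[K i0 w : probability T R]_y f (U w, y)))
  [set A `*` B | A in measurable & B in measurable]).
- apply: il_integral => [w|f mf f0].
    apply: (il_mull (fin_num01 (c01 w)) _ (@il_eval _ _ R (U w, W i0 w))).
    by case/andP : (c01 w).
  by apply: emeasurable_funM => //; exact: (measurableT_comp mf (mUW i0)).
- apply: il_integral => [w|f mf f0].
    apply: (il_mull (fin_num01 (c'01 w)) _ (il_comp (pair1_measurable (U w)) (il_measure (K i0 w : probability T R)))).
    by case/andP : (c'01 w).
  by apply: emeasurable_funM => //; exact: measurable_fun_kernel_integral.
- exact: measurable_prod_measurableType.
- move=> _ _ [A1 mA1 [B1 mB1 <-]] [A2 mA2 [B2 mB2 <-]].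
  rewrite -setXI; exists (A1 `&` A2); first exact: measurableI.
  by exists (B1 `&` B2) => //; exact: measurableI.
- move=> _ [A mA [B mB <-]].
  rewrite -(EL (fun z => (\1_(A `*` B) z)%:E)) -(ER (fun z => (\1_(A `*` B) z)%:E)).
  have mAB : measurable_fun setT (fun z : S * T => (\1_(A `*` B) z : R)%:E).
    by apply/measurable_EFinP; apply: measurable_indic; exact: measurableX.
  apply: IH; [exact: (g1rect _ A B)|exact: mg1|].
  by apply: g101 => z; exact: indic01.
- rewrite -(EL (fun=> 1)) -(ER (fun=> 1)).
  apply: IH; [|exact: mg1|].
  + apply: (g1rect _ setT setT) => //.
    by apply/funext => z; rewrite setXTT indicT.
  + by apply: g101 => z; rewrite lee01 lexx.
- apply: le_lt_trans (ltry 1%R); under eq_integral do rewrite mule1.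
  by case/andP : (integral01 P mc c01).
- exact: mg.
- by move=> x; case/andP : (g01 i0 x).
Qed.

End conditional_independence.

(** * Stick-breaking moments *)

Section beta_integral.
Context (R : realType).
Local Notation mu := (@lebesgue_measure R).

Let F (b x : R) := - (b^-1 * (1 - x) `^ b).

Let is_derive_F (b x : R) : 0 < b -> x < 1 -> is_derive x 1 (F b) ((1 - x) `^ (b - 1)).
Proof.
move=> b0 x1; have x10 : 0 < 1 - x by rewrite subr_gt0.
have H := is_derive1_powR b x10.
have H1 : is_derive x (1 : R) (fun x : R => 1 - x) (-1).
  have := is_deriveB (is_derive_cst (1 : R) x (1 : R)) (is_derive_id x (1 : R)).
  by rewrite sub0r.
have H2 := @is_derive1_comp _ (fun y : R => y `^ b) (fun x : R => 1 - x) x _ _ H H1.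
have H3 := is_deriveN (is_deriveZ b^-1 H2).
apply: (@is_derive_eq _ _ _ _ _ _ _ _ H3).
rewrite mulrN1 scalerN opprK /GRing.scale /= mulrA mulVf ?mul1r//.
by rewrite gt_eqF.
Qed.

Let seq_itv : \bigcup_n `[0, 1 - n.+2%:R^-1]%classic = `[0 : R, 1[%classic.
Proof.
apply/seteqP; split => x /=.
  move=> [n _] /=; rewrite !in_itv /= => /andP[-> xn] /=.
  by apply: (le_lt_trans xn); rewrite ltrBlDr ltrDl invr_gt0 ltr0n.
rewrite in_itv /= => /andP[x0 x1].
have d0 : 0 < 1 - x by rewrite subr_gt0.
exists (Num.trunc (1 - x)^-1) => //=; rewrite in_itv /= x0 /= lerBrDr -lerBrDl.
rewrite -[leRHS]invrK lef_pV2 ?posrE ?invr_gt0// ?ltr0n//.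
apply/ltW; apply: (@lt_trans _ _ (Num.trunc (1 - x)^-1).+1%:R); last by rewrite ltr_nat.
by rewrite truncnS_gt.
Qed.

(** For b < 1 the integrand is unbounded at 1, so the fundamental theorem of calculus is applied on
    [0, 1 - 1/(n+2)] with antiderivative [F b], and n tends to infinity. The offset 2 keeps the
    right endpoint above 0. *)
Lemma integral_onem_powR (b : R) : 0 < b ->
  (\int[mu]_(x in `]0%R, 1%R[) ((1 - x) `^ (b - 1))%:E = (b^-1)%:E)%E.
Proof.
move=> b0.
have mf D : measurable_fun D (fun x : R => ((1 - x) `^ (b - 1))%:E).
  apply/measurable_EFinP; apply: (measurable_funS measurableT) => //.
  have m1 : measurable_fun [set: R] (fun x : R => 1 - x) by exact: measurable_funB.
  exact: (measurableT_comp (measurable_powR (b - 1)) m1).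
transitivity (\int[mu]_(x in `[0%R, 1%R[) ((1 - x) `^ (b - 1))%:E)%E.
  by rewrite integral_itv_obnd_cbnd.
rewrite -seq_itv.
have c1 n : 1 - n.+2%:R^-1 < 1 :> R by rewrite ltrBlDr ltrDl invr_gt0 ltr0n.
have c0 n : 0 < 1 - n.+2%:R^-1 :> R by rewrite subr_gt0 invf_lt1 ?ltr1n ?ltr0n.
have cF x : x < 1 -> {for x, continuous (F b)}.
  move=> x1; apply: differentiable_continuous; apply/derivable1_diffP.
  exact: (@ex_derive _ _ _ _ _ _ _ (is_derive_F b0 x1)).
have IE n : (\int[mu]_(x in `[0%R, (1 - n.+2%:R^-1)%R]) ((1 - x) `^ (b - 1))%:E =
    (b^-1 - b^-1 * n.+2%:R^-1 `^ b)%:E)%E.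
  rewrite (@continuous_FTC2 _ _ (F b)) //.
  - by rewrite -EFinB /F subr0 powR1 mulr1 opprK subKr addrC.
  - apply: continuous_in_subspaceT => x; rewrite inE /= in_itv /= => /andP[_ xn].
    have x1 : 0 < 1 - x by rewrite subr_gt0 (le_lt_trans xn).
    apply: (@continuous_comp _ _ _ (fun x : R => 1 - x) (fun y => y `^ (b - 1))).
      by apply: cvgB; [exact: cvg_cst|exact: cvg_id].
    apply: differentiable_continuous; apply/derivable1_diffP.
    exact: (@ex_derive _ _ _ _ _ _ _ (is_derive1_powR (b - 1) x1)).
  - split.
    + move=> x; rewrite in_itv /= => /andP[_ xn].
      exact: (@ex_derive _ _ _ _ _ _ _ (is_derive_F b0 (lt_trans xn (c1 n)))).
    + by apply: cvg_at_right_filter; apply: cF.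
    + by apply: cvg_at_left_filter; apply: cF.
  - move=> x; rewrite in_itv /= => /andP[_ xn]; rewrite derive1E.
    exact: (@derive_val _ _ _ _ _ _ _ (is_derive_F b0 (lt_trans xn (c1 n)))).
pose A n := `[(0 : R), 1 - n.+2%:R^-1]%classic.
pose f (x : R) := ((1 - x) `^ (b - 1))%:E.
have H1 := @ge0_nondecreasing_set_cvg_integral _ (measurableTypeR R) R A f mu.
rewrite -(cvg_lim (@ereal_hausdorff R) (H1 _ _ _ _)) => {H1} //.
- apply: (cvg_lim (@ereal_hausdorff R)).
  under eq_fun do rewrite IE.
  apply: cvg_EFin; first by apply: nearW.
  rewrite -[X in _ --> X]subr0 -[X in _ - X](mulr0 b^-1).
  apply: cvgB; first exact: cvg_cst.
  apply: cvgMr.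
  move/cvg_at_rightP : (powR_cvg0 b0); apply; split => [n|].
    by rewrite invr_gt0 ltr0n.
  by have := @cvg_harmonic R; rewrite -(cvg_shiftS (@harmonic R)).
- move=> m n mn; apply/subsetPset => x; rewrite /A /= !in_itv /= => /andP[-> xm] /=.
  by apply: (le_trans xm); rewrite lerB// lef_pV2 ?posrE// ler_nat.
- by move=> i; exact: measurable_itv.
- by move=> i; exact: mf.
- by move=> i x _; rewrite lee_fin powR_ge0.
Qed.

End beta_integral.

Section beta_mean.
Context (R : realType).
Local Open Scope ereal_scope.
Local Notation mu := (@lebesgue_measure R).

(** Expectation under Beta(1, a), whose density is a (1 - x)^(a - 1) on ]0,1[. As a bare functional
    it can be compared with [\int[P]_w g (psi k w)] through [integral_like_ext]. *)
Definition beta_mean (a : R) (g : R -> \bar R) : \bar R :=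
  a%:E * \int[mu]_x ((\1_`]0%R, 1%R[ x * (1 - x) `^ (a - 1))%:E * g x).

Let dens01 (a x : R) : 0 <= (\1_`]0%R, 1%R[ x * (1 - x) `^ (a - 1))%:E.
Proof. by rewrite lee_fin mulr_ge0// powR_ge0. Qed.

Let mdens (a : R) : measurable_fun [set: R] (fun x => (\1_`]0%R, 1%R[ x * (1 - x) `^ (a - 1))%:E).
Proof.
apply/measurable_EFinP; apply: measurable_funM; first exact: measurable_indic.
have m1 : measurable_fun [set: R] (fun x : R => (1 - x)%R) by exact: measurable_funB.
exact: (measurableT_comp (measurable_powR (a - 1)) m1).
Qed.

Lemma il_beta_mean (a : R) : (0 < a)%R -> integral_like (beta_mean a).
Proof.
move=> a0; apply: il_mull => //; first by rewrite lee_fin ltW.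
apply: (@il_integral _ _ _ _ (measurableTypeR R)) => [x|g mg g0].
  by apply: il_mull => //; exact: il_eval.
by apply: emeasurable_funM => //; exact: mdens.
Qed.

Lemma beta_lawE (a : R) (B : set R) : (0 < a)%R -> measurable B ->
  beta_law 1 a B = beta_mean a (fun x => (\1_B x)%:E).
Proof.
move=> a0 mB.
have dE x : beta_density 1 a x = ((1 - x) `^ (a - 1))%R.
  by rewrite /beta_density subrr powRr0 mul1r.
rewrite /beta_law.
under eq_integral do rewrite dE.
rewrite integral_onem_powR//= invrK; congr (_ * _).
rewrite integral_mkcond; apply: eq_integral => x _.
rewrite epatch_indic /= dE setIC indicI /= -!EFinM; congr EFin.
by rewrite mulrA; congr (_ * _)%R; rewrite mulrC.
Qed.

(** Origin of the ratios in the bound: the factor 1 - x raises the exponent of the density by one,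
    and the resulting integral is 1/(a + 1). *)
Lemma beta_mean_onem (a : R) : (0 < a)%R -> beta_mean a (fun x => (1 - x)%:E) = (a / (a + 1))%:E.
Proof.
move=> a0; rewrite /beta_mean EFinM; congr (_ * _).
rewrite -(_ : (a + 1 - 1 = a)%R); last by rewrite addrK.
have a1 : (0 < a + 1)%R by rewrite addr_gt0.
rewrite addrK -integral_onem_powR// [RHS]integral_mkcond; apply: eq_integral => x _.
rewrite epatch_indic /= -!EFinM addrK indicE mem_setE.
have [|_] := boolP (x \in `]0%R, 1%R[); last by rewrite !mul0r mulr0.
rewrite in_itv /= => /andP[_ x1]; congr EFin.
by rewrite mul1r mulr1 mulrC mulr_powRB1// subr_ge0 ltW.
Qed.

Lemma beta_mean1 (a : R) : (0 < a)%R -> beta_mean a (fun=> 1) = 1.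
Proof.
move=> a0; rewrite /beta_mean; transitivity (a%:E * (a^-1)%:E); last first.
  by rewrite -EFinM mulfV// gt_eqF.
rewrite -integral_onem_powR// [in RHS]integral_mkcond; congr (_ * _).
by apply: eq_integral => x _; rewrite epatch_indic /= mule1 EFinM muleC.
Qed.

Lemma beta_mean01 (a : R) (g : R -> \bar R) : (0 < a)%R -> measurable_fun setT g ->
  (forall x, 0 <= g x <= 1) -> 0 <= beta_mean a g <= 1.
Proof.
move=> a0 mg g01; have g0 x : 0 <= g x by case/andP : (g01 x).
rewrite (il_ge0 (il_beta_mean a0))//= -[leRHS](beta_mean1 a0).
by apply: (il_le (il_beta_mean a0)) => // x; case/andP : (g01 x).
Qed.

(** The sure event and a single index turn the conditional specification into the unconditional law
    of [psi k], first on sets and then for functions. *)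
Lemma cond_indep_beta (d : measure_display) (Omega : measurableType d) (P : probability Omega R)
    (H : set (set Omega)) (D : set nat) (psi : nat -> {mfun Omega >-> R}) a k (g : R -> \bar R) :
  (0 < a)%R -> cond_indep_laws P H D psi (fun _ _ => beta_law 1 a) -> D k ->
  measurable_fun setT g -> (forall x, 0 <= g x) ->
  \int[P]_w g (psi k w) = beta_mean a g.
Proof.
move=> a0 Hpsi Dk mg g0.
have E (B : set R) : measurable B -> P (psi k @^-1` B) = beta_law 1 a B.
  move=> mB; have := @cond_indep_laws_seq _ _ _ P H _ _ _ _ _ _ Hpsi setT [:: k] (fun=> B).
  move=> /(_ (@measurableT _ (g_sigma_algebraType H))) /(_ isT).
  have kD : [set` [:: k]] `<=` D by move=> i /=; rewrite inE => /eqP ->.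
  move=> /(_ kD (fun=> mB)); rewrite setTI.
  rewrite bigcap_seq big_seq1 => ->.
  under eq_integral do rewrite big_seq1.
  by rewrite integral_prob_cst.
have E' (B : set R) : measurable B ->
    \int[P]_w (\1_B (psi k w))%:E = beta_mean a (fun x => (\1_B x)%:E).
  move=> mB; rewrite -beta_lawE// -E//.
  have mpB : measurable (psi k @^-1` B) by rewrite -[X in measurable X]setTI; exact: measurable_funP.
  by rewrite -[X in P X]setIT -integral_indic.
apply: (integral_like_ext (Phi := fun g : R -> \bar R => \int[P]_w g (psi k w)) (Psi := beta_mean a) (G := measurable)).
- apply: il_integral => [w|f mf f0]; first exact: il_eval.
  exact: (measurableT_comp mf (measurable_funPT (psi k))).
- exact: il_beta_mean.
- by rewrite sigma_algebra_id//; exact: sigma_algebra_measurable.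
- by move=> A B; exact: measurableI.
- exact: E'.
- have := E' setT measurableT.
  have -> : (fun x : R => (\1_[set: R] x : R)%:E) = fun=> 1 by apply/funext => x; rewrite indicT.
  by under eq_integral do rewrite indicT.
- by rewrite integral_prob_cst ltry.
- exact: mg.
- exact: g0.
Qed.

End beta_mean.

(** * Pointwise algebra of stick-breaking products *)

Section stick_algebra.
Context (R : realType).

(* Beta variables lie in [0,1] only almost surely; clipping makes all bounds
   on the sticks pointwise. *)
Definition clip01 (u : R) : R := Num.max 0 (Num.min u 1).

Lemma clip01_itv u : 0 <= clip01 u <= 1.
Proof. by rewrite /clip01 le_max lexx /= ge_max ler01 ge_min lexx orbT. Qed.

Lemma clip01_id u : 0 <= u <= 1 -> clip01 u = u.
Proof. by move=> /andP[u0 u1]; rewrite /clip01 (min_idPl _)// (max_idPr _). Qed.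

Lemma measurable_clip01 : measurable_fun setT clip01.
Proof. by apply: measurable_maxr => //; exact: measurable_minr. Qed.

(** The contribution of stick t to weight l, equal to 1 for t > l. Padding by 1 writes all weights
    as products over a common range of t, so a product of several weights can be regrouped stick by
    stick. *)
Definition stick_factor (l t : nat) (u : R) : R :=
  if t == l then u else if (t < l)%N then 1 - u else 1.

Lemma stick_factor01 l t u : 0 <= u <= 1 -> 0 <= stick_factor l t u <= 1.
Proof.
move=> /andP[u0 u1]; rewrite /stick_factor; case: ifP => _; first by rewrite u0.
by case: ifP => _; rewrite ?ler01 ?lexx// subr_ge0 u1 lerBlDr lerDl.
Qed.

Lemma measurable_stick_factor l t : measurable_fun setT (stick_factor l t).
Proof.
rewrite /stick_factor; case: (t == l) => //.
by case: (t < l)%N => //; exact: measurable_funB.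
Qed.

Lemma stickE (psi : nat -> R) (k N : nat) : (k < N)%N ->
  stick psi k = \prod_(t < N) stick_factor k t (psi t).
Proof.
elim: N => // N IH; rewrite ltnS leq_eqVlt => /orP[/eqP ->|kN].
  rewrite big_ord_recr /= {2}/stick_factor eqxx mulrC; congr (_ * _).
  by apply: eq_bigr => t _; rewrite /stick_factor ltn_eqF ?ltn_ord.
by rewrite big_ord_recr /= -IH// /stick_factor gtn_eqF// ltnNge ltnW// mulr1.
Qed.

Lemma sum_stick (psi : nat -> R) N :
  \sum_(k < N) stick psi k = 1 - \prod_(t < N) (1 - psi t).
Proof.
elim: N => [|N IH]; first by rewrite !big_ord0 subrr.
rewrite !big_ord_recr /= IH /stick; ring.
Qed.

Lemma stick01 (psi : nat -> R) k : (forall t, 0 <= psi t <= 1) -> 0 <= stick psi k <= 1.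
Proof.
move=> psi01; rewrite (@stickE _ _ k.+1)//.
elim/big_ind : _ => //; first by rewrite ler01 lexx.
  by move=> x y /andP[x0 x1] /andP[y0 y1]; rewrite mulr_ge0//= mulr_ile1.
by move=> t _; exact: stick_factor01.
Qed.

Lemma prod_onem01 (psi : nat -> R) N : (forall t, 0 <= psi t <= 1) ->
  0 <= \prod_(t < N) (1 - psi t) <= 1.
Proof.
move=> psi01; elim/big_ind : _ => //; first by rewrite ler01 lexx.
  by move=> x y /andP[x0 x1] /andP[y0 y1]; rewrite mulr_ge0//= mulr_ile1.
by move=> t _; case/andP : (psi01 t) => p0 p1; rewrite subr_ge0 p1 lerBlDr lerDl.
Qed.

(* Young's inequality: the graph of x ^+ n.+1 lies above its tangent line at c. *)
Lemma tangent_exprS (x c : R) n : 0 <= x -> 0 <= c ->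
  n.+1%:R * c ^+ n * x <= x ^+ n.+1 + n%:R * c ^+ n.+1.
Proof.
move=> x0 c0; elim: n => [|n IH]; first by rewrite !expr1 expr0 mul1r mul0r addr0 mul1r.
have H1 : 0 <= x * (x ^+ n.+1 + n%:R * c ^+ n.+1 - n.+1%:R * c ^+ n * x).
  by rewrite mulr_ge0// subr_ge0.
have H2 : 0 <= n.+1%:R * c ^+ n * (x - c) ^+ 2.
  by rewrite mulr_ge0 ?sqr_ge0// mulr_ge0// exprn_ge0.
rewrite -subr_ge0; move: (addr_ge0 H1 H2); congr (0 <= _).
rewrite !exprS -!natr1; ring.
Qed.

End stick_algebra.

(** * Integration over independent Beta sticks *)

Section sticks.
Local Open Scope ereal_scope.
Context (R : realType) (d : measure_display) (Omega : measurableType d).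
Variables (P : probability Omega R) (H : set (set Omega)).
Hypothesis HM : H `<=` measurable.
Variables (D : set nat) (psi : nat -> {mfun Omega >-> R}) (a : R).
Hypothesis a0 : (0 < a)%R.
Hypothesis Hpsi : cond_indep_laws P H D psi (fun _ _ => beta_law 1 a).

Lemma ae_clip01 k : D k -> {ae P, forall w, clip01 (psi k w) = psi k w}.
Proof.
move=> Dk; pose B : set R := ~` `[0%R, 1%R].
have mB : measurable B by exact: measurableC.
have mpB : measurable (psi k @^-1` B).
  by rewrite -[X in measurable X]setTI; exact: measurable_funP.
exists (psi k @^-1` B); split => //.
  rewrite -[X in P X]setIT -integral_indic//.
  have := @cond_indep_beta _ _ _ P H D psi a k (fun x => (\1_B x)%:E) a0 Hpsi Dk.
  move=> /= ->.
  - rewrite /beta_mean integral0_eq ?mule0// => x _.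
    rewrite -EFinM; congr EFin; rewrite !indicE /B in_setC !mem_setE.
    have [|_] := boolP (x \in `]0%R, 1%R[); last by rewrite !mul0r.
    rewrite !in_itv /= => /andP[/ltW-> /ltW->] /=.
    by rewrite mulr0.
  - by apply/measurable_EFinP; exact: measurable_indic.
  - by move=> x; rewrite lee_fin.
move=> w /=; rewrite /B /= in_itv /= => H1 H2; apply: H1.
exact: clip01_id.
Qed.

Lemma sticks_integral (N : nat) (Z : Omega -> \bar R) (G : nat -> R -> \bar R) :
  (forall k, (k < N)%N -> D k) ->
  measurable_fun [set: g_sigma_algebraType H] Z -> (forall w, 0 <= Z w <= 1) ->
  (forall t, measurable_fun setT (G t)) -> (forall t u, 0 <= G t u <= 1) ->
  \int[P]_w (Z w * \prod_(t < N) G t (psi t w)) =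
  \prod_(t < N) beta_mean a (G t) * \int[P]_w Z w.
Proof.
move=> ND mZ Z01 mG G01.
have sD : [set` iota 0 N] `<=` D by move=> k /=; rewrite mem_iota => /andP[_] /ND.
(* [beta_law] is a bare set function, while [cond_indep_integral] needs kernels that are bundled
   probabilities; the distribution of [psi i] serves as one and agrees with [beta_law] by
   [cond_indep_beta]. *)
pose K (i : nat) (w : Omega) : pprobability R R := distribution P (psi i).
have KE i w B : D i -> measurable B -> beta_law 1 a B = (K i w : probability R R) B.
  move=> Di mB; rewrite beta_lawE//.
  rewrite -(@cond_indep_beta _ _ _ P H D psi a i)//.
  - transitivity (P (psi i @^-1` B)) => //; rewrite -[X in P X]setIT -integral_indic//.
    by rewrite -[X in measurable X]setTI; exact: measurable_funP.
  - by apply/measurable_EFinP; exact: measurable_indic.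
have := @cond_indep_integral _ _ _ P H HM nat _ R D psi (fun i => measurable_funPT (psi i))
  _ Hpsi K (fun i => measurable_cst _) KE _ unit (fun=> tt) Z (iota 0 N) (fun i z => G i z.2).
move=> /(_ (measurable_cst _) mZ Z01 (iota_uniq _ _) sD).
move=> /(_ (fun i => measurableT_comp (mG i) measurable_snd) (fun i z => G01 i z.2)).
have E (T : Type) (F : nat -> T -> \bar R) x : \prod_(i <- iota 0 N) F i x = \prod_(t < N) F t x.
  by rewrite -{1}(subn0 N) -/(index_iota 0 N) big_mkord.
under eq_integral do rewrite (E _ (fun i w => G i (psi i w))).
move=> ->.
have int_K i w : (i < N)%N -> \int[K i w : probability R R]_y G i y = beta_mean a (G i).
  move=> iN; rewrite ge0_integral_pushforward//=; last by move=> y _; case/andP : (G01 i y).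
  rewrite (cond_indep_beta a0 Hpsi (ND _ iN))// => x; by case/andP : (G01 i x).
rewrite -ge0_integralZl//.
- apply: eq_integral => w _; rewrite muleC; congr (_ * _).
  rewrite (E _ (fun i w => \int[K i w : probability R R]_y G i y)).
  by apply: eq_bigr => i _; exact: int_K.
- exact: (measurable_fun_sub HM).
- by move=> w _; case/andP : (Z01 w).
- apply: prode_ge0 => i _; apply: (il_ge0 (il_beta_mean a0)) => // x.
  by case/andP : (G01 i x).
Qed.

End sticks.

(** * Mixed moments of stick-breaking weights *)

Section stick_moments.
Local Open Scope ereal_scope.
Context (R : realType).

Definition clip_stick (d : measure_display) (Omega : measurableType d)
  (psi : nat -> {mfun Omega >-> R}) (w : Omega) : nat -> R :=
  stick (fun t => clip01 (psi t w)).

(* E[prod_(j | Q j) w_(l j)] for stick-breaking weights w, when all the [l j] are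
   below [N]: the independent sticks psi_t are integrated one at a time. *)
Definition stick_mom (a : R) (N : nat) (J : finType) (Q : pred J) (l : J -> nat) : \bar R :=
  \prod_(t < N) beta_mean a (fun u => \prod_(j | Q j) (stick_factor (l j) t (clip01 u))%:E).

Lemma stick_mom01 (a : R) (N : nat) (J : finType) (Q : pred J) (l : J -> nat) :
  (0 < a)%R -> 0 <= stick_mom a N Q l <= 1.
Proof.
move=> a0; apply: prode_01 => t _; apply: beta_mean01 => // [|u].
  apply: emeasurable_prod => j _; apply/measurable_EFinP.
  exact: (measurableT_comp (@measurable_stick_factor R (l j) t) (@measurable_clip01 R)).
by apply: prode_01 => j _; rewrite !lee_fin stick_factor01// clip01_itv.
Qed.

Lemma stick_mom_ge0 (a : R) (N : nat) (J : finType) (Q : pred J) (l : J -> nat) :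
  (0 < a)%R -> 0 <= stick_mom a N Q l.
Proof. by move=> a0; case/andP : (stick_mom01 N Q l a0). Qed.

Lemma clip_stick01 (d : measure_display) (Omega : measurableType d)
  (psi : nat -> {mfun Omega >-> R}) (w : Omega) k : (0 <= clip_stick psi w k <= 1)%R.
Proof. by apply: stick01 => t; exact: clip01_itv. Qed.

Lemma measurable_clip_stick (d : measure_display) (Omega : measurableType d)
  (psi : nat -> {mfun Omega >-> R}) d' (Om' : measurableType d') (V : Om' -> Omega) k :
  (forall t, (t <= k)%N -> measurable_fun [set: Om'] (psi t \o V)) ->
  measurable_fun [set: Om'] (fun w => clip_stick psi (V w) k).
Proof.
move=> mV; rewrite /clip_stick /stick.
have mc t : (t <= k)%N -> measurable_fun [set: Om'] (fun w => clip01 (psi t (V w))).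
  by move=> tk; apply: (measurableT_comp (@measurable_clip01 R)); exact: mV.
apply: measurable_funM; first exact: mc.
apply: measurable_prod => t _.
by apply: measurable_funB => //; apply: mc; exact: ltnW.
Qed.

Section gem_weights.
Context (d : measure_display) (Omega : measurableType d).
Variables (P : probability Omega R) (H : set (set Omega)).
Variables (N : option nat) (psi : nat -> {mfun Omega >-> R}) (a : R).
Hypothesis a0 : (0 < a)%R.
Hypothesis Hpsi : cond_indep_laws P H (stick_index N) psi (fun _ _ => beta_law 1 a).

Lemma sum_clip_stick_le1 w m : (\sum_(k < m) clip_stick psi w k <= 1)%R.
Proof.
rewrite sum_stick lerBlDr lerDl.
by case/andP : (@prod_onem01 R (fun t => clip01 (psi t w)) m (fun t => clip01_itv _)).
Qed.

(** Clipping alters the sticks only on a null set. In the truncated case the weight of the last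
    index is a remainder rather than a stick product: only its sign is claimed, and it follows from
    partial sums being at most 1. *)
Lemma ae_gem_weight : {ae P, forall w,
  (forall k, 0 <= gem_weight N (psi ^~ w) k)%R /\
  (forall k, stick_index N k -> gem_weight N (psi ^~ w) k = clip_stick psi w k)}.
Proof.
have : {ae P, forall w, forall k, stick_index N k -> clip01 (psi k w) = psi k w}.
  apply: ae_foralln => k; have [Nk|Nk] := pselect (stick_index N k); last by apply: aeW.
  have := ae_clip01 a0 Hpsi Nk.
  by apply: filterS => w ? _.
apply: filterS => w cpsi.
have E k : stick_index N k -> stick (psi ^~ w) k = clip_stick psi w k.
  move=> Nk; rewrite /clip_stick /stick cpsi//; congr (_ * _)%R.
  apply: eq_bigr => t _; rewrite cpsi//.
  move: Nk; case: (N) => //= N'; apply: leq_trans; rewrite ltnS; exact/ltnW/ltn_ord.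
have G k : stick_index N k -> gem_weight N (psi ^~ w) k = clip_stick psi w k.
  move=> Nk; rewrite -E// /gem_weight; case: (N) Nk => //= N' ->.
  by [].
split => // k.
have [/G ->|] := pselect (stick_index N k).
  by case/andP : (clip_stick01 psi w k).
rewrite /gem_weight; case: (N) E => //= N' E /negP /negbTE ->.
case: eqP => // kN.
rewrite subr_ge0.
have -> : (\sum_(t < k) stick (psi ^~ w) t = \sum_(t < k) clip_stick psi w t)%R.
  by apply: eq_bigr => t _; rewrite E// -kN ltnS.
exact: sum_clip_stick_le1.
Qed.

End gem_weights.

Section stick_mixture.
Context (d : measure_display) (Omega : measurableType d).
Variables (P : probability Omega R) (H : set (set Omega)).
Hypothesis HM : H `<=` measurable.
Variables (D : set nat) (psi : nat -> {mfun Omega >-> R}) (a : R) (N : nat).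
Hypothesis a0 : (0 < a)%R.
Hypothesis Hpsi : cond_indep_laws P H D psi (fun _ _ => beta_law 1 a).
Hypothesis ND : forall k, (k < N)%N -> D k.
Variables (J : finType) (Q : pred J).

Let factor01 (l : J -> nat) (t : nat) (u : R) :
  0 <= \prod_(j | Q j) (stick_factor (l j) t (clip01 u))%:E <= 1.
Proof. by apply: prode_01 => j _; rewrite !lee_fin stick_factor01// clip01_itv. Qed.

Let mfactor (l : J -> nat) (t : nat) :
  measurable_fun setT (fun u : R => \prod_(j | Q j) (stick_factor (l j) t (clip01 u))%:E).
Proof.
apply: emeasurable_prod => j _; apply/measurable_EFinP.
exact: (measurableT_comp (@measurable_stick_factor R (l j) t) (@measurable_clip01 R)).
Qed.

Lemma prod_clip_stick (l : J -> nat) w : (forall j, (l j < N)%N) ->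
  \prod_(j | Q j) (clip_stick psi w (l j))%:E =
  \prod_(t < N) (\prod_(j | Q j) (stick_factor (l j) t (clip01 (psi t w)))%:E).
Proof.
move=> lN; rewrite exchange_big /=; apply: eq_bigr => j _.
by rewrite /clip_stick (stickE _ (lN j)) -prodEFin.
Qed.

Lemma stick_mom_integral (l : J -> nat) (Z : Omega -> \bar R) :
  (forall j, (l j < N)%N) ->
  measurable_fun [set: g_sigma_algebraType H] Z -> (forall w, 0 <= Z w <= 1) ->
  \int[P]_w (\prod_(j | Q j) (clip_stick psi w (l j))%:E * Z w) =
  stick_mom a N Q l * \int[P]_w Z w.
Proof.
move=> lN mZ Z01.
have := sticks_integral HM a0 Hpsi ND mZ Z01 (mfactor l) (factor01 l).
rewrite /stick_mom => <-.
by apply: eq_integral => w _; rewrite muleC prod_clip_stick.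
Qed.

(** Serves both levels of the hierarchy: the atoms of a Dirichlet process, and the subgroup measures
    as atoms of Q. The atoms are averaged given the sticks; as [K] and [U] depend on [H] only, the
    sticks then separate into the factor [stick_mom]. *)
Lemma stick_mixture_integral dT (Tm : measurableType dT) d1 (S : measurableType d1)
    (D' : set nat) (W : nat -> {mfun Omega >-> Tm}) (K : Omega -> pprobability Tm R)
    (U : Omega -> S) (l : J -> nat) (g : nat -> S * Tm -> \bar R) :
  (forall k, (k < N)%N -> D' k) ->
  cond_indep_laws P (H `|` events_of D psi) D' W (fun _ w => K w : probability Tm R) ->
  measurable_fun [set: g_sigma_algebraType H] K ->
  measurable_fun [set: g_sigma_algebraType H] U ->
  (forall j, (l j < N)%N) ->
  (forall k, measurable_fun setT (g k)) -> (forall k z, 0 <= g k z <= 1) ->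
  \int[P]_w (\prod_(j | Q j) (clip_stick psi w (l j))%:E * \prod_(k < N) g k (U w, W k w)) =
  stick_mom a N Q l * \int[P]_w \prod_(k < N) \int[K w : probability Tm R]_y g k (U w, y).
Proof.
move=> ND' HW mK mU lN mg g01.
have mHpsi t : (t < N)%N -> measurable_fun [set: g_sigma_algebraType (H `|` events_of D psi)] (psi t).
  move=> tN; apply: measurable_fun_events => A [B mB <-]; right.
  by exists t; [exact: ND|exists B].
have HM' : H `|` events_of D psi `<=` measurable.
  by rewrite subUset; split => //; exact: events_of_measurable.
have sD : [set` iota 0 N] `<=` D' by move=> k /=; rewrite mem_iota => /andP[_] /ND'.
have E (T' : Type) (F : nat -> T' -> \bar R) x : \prod_(i <- iota 0 N) F i x = \prod_(t < N) F t x.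
  by rewrite -{1}(subn0 N) -/(index_iota 0 N) big_mkord.
under eq_integral do rewrite -(E _ (fun k w => g k (U w, W k w))).
rewrite (cond_indep_integral HM' _ HW (K := fun _ => K)) //.
- under eq_integral do rewrite (E _ (fun k w => \int[K w : probability Tm R]_y g k (U w, y))).
  apply: stick_mom_integral => //.
  + apply: emeasurable_prod => k _.
    apply: measurable_fun_kernel_integral => // x; by case/andP : (g01 k x).
  + move=> w; apply: prode_01 => k _; apply: integral01 => //.
    by apply: (measurableT_comp (mg k)); exact: measurable_pair1.
- by move=> _; exact: (measurable_fun_sub HM).
- by apply: measurable_fun_sigmaS mU => A; left.
- apply: emeasurable_prod => j _; apply/measurable_EFinP.
  apply: (@measurable_clip_stick _ _ psi _ (g_sigma_algebraType (H `|` events_of D psi)) id) => t tl.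
  by apply: mHpsi; exact: leq_ltn_trans (lN j).
- by move=> w; apply: prode_01 => j _; rewrite !lee_fin clip_stick01.
- exact: iota_uniq.
Qed.

(* The sum is E[W^#|Q|], with W the total weight of the first N sticks. *)
Lemma sum_stick_mom_ge (j0 : 'I_N) :
  ((1 - (a / (a + 1)) ^+ N) ^+ #|Q|)%:E <=
  \sum_(l in pffun_on j0 Q predT) stick_mom a N Q (fun j => (l : {ffun J -> 'I_N}) j).
Proof.
pose c : R := (1 - (a / (a + 1)) ^+ N)%R.
have q01 : (0 <= a / (a + 1) <= 1)%R.
  have a1 : (0 < a + 1)%R by rewrite addr_gt0.
  by rewrite ler_pdivlMr// mul0r ltW//= ler_pdivrMr// mul1r lerDl.
have c0 : (0 <= c)%R by case/andP : q01 => ? ?; rewrite subr_ge0 exprn_ile1.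
pose x (w : Omega) : R := (\sum_(k < N) clip_stick psi w k)%R.
have xE w : x w = (1 - \prod_(t < N) (1 - clip01 (psi t w)))%R by rewrite /x sum_stick.
have x01 w : (0 <= x w <= 1)%R.
  rewrite xE; have /andP[p0 p1] := @prod_onem01 R (fun t => clip01 (psi t w)) N (fun t => clip01_itv _).
  by rewrite subr_ge0 p1 lerBlDr lerDl.
have x0 w : (0 <= x w)%R by case/andP : (x01 w).
have mx : measurable_fun setT x.
  apply: measurable_sum => k.
  by apply: (@measurable_clip_stick _ _ psi _ Omega id) => t _; exact: measurable_funPT.
have mxn n : measurable_fun setT (fun w => (x w ^+ n)%:E).
  by apply/measurable_EFinP; exact: measurable_funX.
(* The complement 1 - W is the product of the independent factors 1 - psi_t, each of mean a / (a +
   1). *)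
have Ex : \int[P]_w (x w)%:E = c%:E.
  have : \int[P]_w (x w)%:E + \int[P]_w (\prod_(t < N) (1 - clip01 (psi t w)))%:E = 1.
    rewrite -ge0_integralD//=.
    - rewrite -[RHS](integral_prob_cst P 1); apply: eq_integral => w _.
      by rewrite -EFinD xE subrK.
    - by move=> w _; rewrite lee_fin.
    - exact/measurable_EFinP.
    - move=> w _; rewrite lee_fin.
      by case/andP : (@prod_onem01 R (fun t => clip01 (psi t w)) N (fun t => clip01_itv _)).
    - apply/measurable_EFinP; apply: measurable_prod => t _; apply: measurable_funB => //.
      exact: (measurableT_comp (@measurable_clip01 R)).
  have -> : \int[P]_w (\prod_(t < N) (1 - clip01 (psi t w)))%:E = ((a / (a + 1)) ^+ N)%:E.
    have := @sticks_integral _ _ _ P H HM D psi a a0 Hpsi N (fun=> 1) (fun _ u => (1 - clip01 u)%:E) ND.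
    under eq_integral do rewrite mul1e prodEFin.
    move=> ->//.
    - rewrite integral_prob_cst mule1 big_const_ord.
      have -> : beta_mean a (fun u => (1 - clip01 u)%:E) = (a / (a + 1))%:E.
        rewrite -beta_mean_onem// /beta_mean; congr (_ * _); apply: eq_integral => u _.
        rewrite indicE mem_setE; have [|_] := boolP (u \in `]0%R, 1%R[); last by rewrite mul0r !mul0e.
        by rewrite in_itv /= => /andP[/ltW u0 /ltW u1]; rewrite clip01_id// u0.
      by elim: (N) => //= n ->; rewrite -EFinM exprS.
    - by move=> w; rewrite lee01 lexx.
    - move=> _; apply/measurable_EFinP; apply: measurable_funB => //.
      exact: measurable_clip01.
    - move=> _ u; rewrite !lee_fin; case/andP : (clip01_itv u) => u0 u1.
      by rewrite subr_ge0 u1 lerBlDr lerDl.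
  move=> E1; apply/eqP; rewrite EFinB -E1 eq_sym; apply/eqP.
  by rewrite addeK.
(* Distributivity expands W^#|Q| over assignments of [Q] to sticks. Functions in
   [pffun_on j0 Q predT] take the default value [j0] outside [Q], so each assignment is counted
   once. *)
have -> : \sum_(l in pffun_on j0 Q predT) stick_mom a N Q (fun j => (l : {ffun J -> 'I_N}) j) =
    \int[P]_w (x w ^+ #|Q|)%:E.
  transitivity (\int[P]_w \sum_(l in pffun_on j0 Q predT)
      \prod_(j | Q j) (clip_stick psi w ((l : {ffun J -> 'I_N}) j))%:E).
    rewrite big_mkcond; under [RHS]eq_integral do rewrite big_mkcond.
    rewrite ge0_integral_sum//.
    - apply: eq_bigr => l _; case: ifPn => _; last by rewrite integral0.
      have := @stick_mom_integral (fun j => l j) (fun=> 1) (fun j => ltn_ord (l j)).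
      rewrite integral_prob_cst mule1 => <-//.
      + by apply: eq_integral => w _; rewrite mule1.
      + by move=> w; rewrite lee01 lexx.
    - move=> l; case: (l \in pffun_on j0 Q predT); last exact: measurable_cst.
      apply: emeasurable_prod => j _; apply/measurable_EFinP.
      by apply: (@measurable_clip_stick _ _ psi _ Omega id) => t _; exact: measurable_funPT.
    - move=> l w _; case: ifPn => // _; apply: prode_ge0 => j _.
      by rewrite lee_fin; case/andP : (clip_stick01 psi w (l j)).
  apply: eq_integral => w _.
  rewrite -prodr_const.
  rewrite /x (big_distr_big j0) /= -sumEFin; apply: eq_bigr => l _.
  by rewrite prodEFin.
(* Exponent 0 is separate because the tangent inequality is stated for a successor exponent. *)
case: #|Q| => [|n].
  by rewrite expr0; under eq_integral do rewrite expr0; rewrite integral_prob_cst.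
(* Jensen's inequality for a power: the tangent at the mean [c] is integrated, and [Ex] makes the
   linear terms combine to c^(n+1). *)
have H1 : \int[P]_w (n.+1%:R * c ^+ n * x w)%:E <= \int[P]_w (x w ^+ n.+1 + n%:R * c ^+ n.+1)%:E.
  apply: ge0_le_integral => //.
  - by move=> w _; rewrite lee_fin mulr_ge0// mulr_ge0// exprn_ge0.
  - by apply/measurable_EFinP; exact: measurable_funM.
  - by apply/measurable_EFinP; apply: measurable_funD => //; exact: measurable_funX.
  - by move=> w _; rewrite lee_fin tangent_exprS.
move: H1; under eq_integral do rewrite EFinM.
under [X in _ <= X -> _]eq_integral do rewrite EFinD.
rewrite ge0_integralZl_EFin//; first last.
- by rewrite mulr_ge0// exprn_ge0.
- exact/measurable_EFinP.
- by move=> w _; rewrite lee_fin.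
rewrite Ex ge0_integralD//; first last.
- by move=> w _; rewrite lee_fin mulr_ge0// exprn_ge0.
- by move=> w _; rewrite lee_fin exprn_ge0.
rewrite integral_prob_cst -EFinM => H2.
rewrite -(leeD2rE (x := (n%:R * c ^+ n.+1)%:E))//; apply: le_trans H2.
by rewrite -EFinD lee_fin exprSr -!natr1 !mulrA -/c; lra.
Qed.

End stick_mixture.
End stick_moments.

(** * Moments of Dirichlet processes *)

Section ereal_distributivity.
Local Open Scope ereal_scope.
Context (R : realType).

(** Distributivity can fail for extended reals; boundedness in [0,1] permits passing to [fine]
    values and using the ring identity. *)
Lemma prode_sume_distr (I J : finType) (j0 : J) (P : pred I) (Q : pred J) (F : I -> J -> \bar R) :
  (forall i j, 0 <= F i j <= 1) ->
  \prod_(i | P i) \sum_(j | Q j) F i j =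
  \sum_(f in pffun_on j0 P Q) \prod_(i | P i) F i ((f : {ffun I -> J}) i).
Proof.
move=> F01; pose r i j := fine (F i j).
have FE i j : F i j = (r i j)%:E by rewrite /r fineK// fin_num01.
under eq_bigr do under eq_bigr do rewrite FE.
under eq_bigr do rewrite sumEFin.
rewrite prodEFin (big_distr_big j0) -sumEFin; apply: eq_bigr => f _.
by rewrite -prodEFin; apply: eq_bigr => i _; rewrite FE.
Qed.

Lemma prode_sume_distr_dep (I J : finType) (Q : I -> pred J) (F : I -> J -> \bar R) :
  (forall i j, 0 <= F i j <= 1) ->
  \prod_i \sum_(j | Q i j) F i j =
  \sum_(f in family Q) \prod_i F i ((f : {ffun I -> J}) i).
Proof.
move=> F01; pose r i j := fine (F i j).
have FE i j : F i j = (r i j)%:E by rewrite /r fineK// fin_num01.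
under eq_bigr do under eq_bigr do rewrite FE.
under eq_bigr do rewrite sumEFin.
rewrite prodEFin bigA_distr_big_dep -sumEFin; apply: eq_bigr => f _.
by rewrite -prodEFin; apply: eq_bigr => i _; rewrite FE.
Qed.

Lemma sume01_le (n : nat) (w : nat -> R) (g : nat -> \bar R) :
  (forall k, 0 <= w k)%R -> (\sum_(k < n) w k <= 1)%R -> (forall k, 0 <= g k <= 1) ->
  0 <= \sum_(k < n) (w k)%:E * g k <= 1.
Proof.
move=> w0 w1 g01; have g0 k : 0 <= g k by case/andP : (g01 k).
apply/andP; split; first by apply: sume_ge0 => k _; rewrite mule_ge0// lee_fin.
apply: (@le_trans _ _ (\sum_(k < n) (w k)%:E)); last by rewrite sumEFin lee_fin.
apply: lee_sum => k _; rewrite -[leRHS]mule1 lee_wpmul2l ?lee_fin//.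
by case/andP : (g01 k).
Qed.

Lemma cvg_prode01 (I : finType) (P : pred I) (u : I -> nat -> \bar R) (l : I -> \bar R) :
  (forall i n, 0 <= u i n <= 1) -> (forall i, 0 <= l i <= 1) ->
  (forall i, u i n @[n --> \oo] --> l i) ->
  \prod_(i | P i) u i n @[n --> \oo] --> \prod_(i | P i) l i.
Proof.
move=> u01 l01 ul.
have uE i n : u i n = (fine (u i n))%:E by rewrite fineK// fin_num01.
have lE i : l i = (fine (l i))%:E by rewrite fineK// fin_num01.
have -> : (fun n => \prod_(i | P i) u i n) = (fun n => (\prod_(i | P i) fine (u i n))%:E).
  by apply/funext => n; rewrite -prodEFin; apply: eq_bigr => i _; rewrite uE.
have -> : \prod_(i | P i) l i = (\prod_(i | P i) fine (l i))%:E.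
  by rewrite -prodEFin; apply: eq_bigr => i _; rewrite lE.
apply: cvg_EFin; first exact: nearW.
have H i : fine (u i n) @[n --> \oo] --> fine (l i).
  by apply: fine_cvg; rewrite -lE; exact: ul.
rewrite /comp /=.
elim: (index_enum I) => [|i s IH].
  by rewrite big_nil; under eq_fun do rewrite big_nil; exact: cvg_cst.
rewrite big_cons; under eq_fun do rewrite big_cons.
by case: (P i) => //; apply: cvgM => //; exact: H.
Qed.

End ereal_distributivity.

Section discrete_integral.
Local Open Scope ereal_scope.
Context (R : realType) (d : measure_display) (T : measurableType d).

Lemma integral_discrete_measure (mu : {measure set T -> \bar R}) (w : nat -> R) (theta : nat -> T)
    (f : T -> \bar R) : (forall k, 0 <= w k)%R ->
  (forall B, measurable B -> mu B = discrete_measure w theta B) ->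
  measurable_fun setT f -> (forall x, 0 <= f x) ->
  \int[mu]_x f x = \sum_(0 <= k <oo) ((w k)%:E * f (theta k)).
Proof.
move=> w0 muE mf f0.
pose m (k : nat) : {measure set T -> \bar R} := mscale (NngNum (w0 k)) (dirac (theta k)).
have mE k : \int[m k]_x f x = (w k)%:E * f (theta k).
  rewrite ge0_integral_mscale//=.
  by rewrite integral_dirac// diracT mul1e.
under eq_eseriesr do rewrite -mE.
rewrite -ge0_integral_measure_series//.
apply: eq_measure_integral => B mB _.
by rewrite muE.
Qed.

End discrete_integral.

Section dirichlet_process.
Local Open Scope ereal_scope.
Context (R : realType) (d : measure_display) (T : measurableType d).
Variables (P0 : probability T R) (a : R).
Hypothesis a0 : (0 < a)%R.
Variables (J : finType) (Q : pred J) (f : J -> T -> \bar R).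
Hypothesis mf : forall j, measurable_fun setT (f j).
Hypothesis f01 : forall j y, 0 <= f j y <= 1.

(* The part of the moment E[prod_(j | Q j) int f_j dG], G ~ DP(a, P0), coming from
   the first n+1 atoms. *)
Definition dp_moment (n : nat) : \bar R :=
  \sum_(c in pffun_on (ord0 : 'I_n.+1) Q predT)
    stick_mom a n.+1 Q (fun j => (c : {ffun J -> 'I_n.+1}) j) *
    \prod_(k < n.+1) \int[P0]_y \prod_(j | Q j && (c j == k)) f j y.

Section representation.
Context (N : option nat) (d' : measure_display) (Omega : measurableType d').
Variables (P : probability Omega R) (psi : nat -> {mfun Omega >-> R})
  (theta : nat -> {mfun Omega >-> T}).
Hypothesis Hpsi : cond_indep_laws P set0 (stick_index N) psi (fun _ _ => beta_law 1 a).
Hypothesis Htheta : cond_indep_laws P (events_of (stick_index N) psi) (atom_index N) theta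
        (fun _ _ => P0).
Variable n : nat.
Hypothesis nN : forall k, (k < n.+1)%N -> stick_index N k.

Definition truncated_mean (w : Omega) (j : J) : \bar R :=
  \sum_(k < n.+1) (clip_stick psi w k)%:E * f j (theta k w).

Lemma truncated_mean01 w j : 0 <= truncated_mean w j <= 1.
Proof.
apply: (sume01_le (w := clip_stick psi w) (g := fun k => f j (theta k w))) => //.
  by move=> k; case/andP : (clip_stick01 psi w k).
exact: sum_clip_stick_le1.
Qed.

Lemma measurable_truncated_mean j : measurable_fun setT (truncated_mean ^~ j).
Proof.
apply: emeasurable_sum => k; apply: emeasurable_funM.
  apply/measurable_EFinP.
  by apply: (@measurable_clip_stick _ _ _ psi _ Omega id) => t _; exact: measurable_funPT.
exact: (measurableT_comp (mf j)).
Qed.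

(** Expanding the product lets each j choose an atom, and the i.i.d. atoms are integrated
    separately. The result depends neither on the truncation level nor on the representation, so
    truncated and untruncated processes become comparable. *)
Lemma truncated_mean_integral :
  \int[P]_w \prod_(j | Q j) truncated_mean w j = dp_moment n.
Proof.
have N' k : (k < n.+1)%N -> atom_index N k.
  by move=> /nN; case: (N) => //= N'; exact: ltnW.
have sf01 w j (k : 'I_n.+1) : 0 <= (clip_stick psi w k)%:E * f j (theta k w) <= 1.
  by apply: mule_le1 => //; rewrite !lee_fin clip_stick01.
under eq_integral do rewrite (prode_sume_distr ord0)//.
under eq_integral do rewrite big_mkcond.
rewrite ge0_integral_sum//; last 2 first.
- move=> c; case: (c \in _); last exact: measurable_cst.
  apply: emeasurable_prod => j _; apply: emeasurable_funM.
    apply/measurable_EFinP.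
    by apply: (@measurable_clip_stick _ _ _ psi _ Omega id) => t _; exact: measurable_funPT.
  exact: (measurableT_comp (mf j)).
- move=> c w _; case: ifPn => // _.
  by apply: prode_ge0 => j _; case/andP : (sf01 w j (c j)).
rewrite /dp_moment [RHS]big_mkcond; apply: eq_bigr => c _.
case: ifPn => _; last by rewrite integral0.
pose g (k : nat) (z : unit * T) := \prod_(j | Q j && (c j == k :> nat)) f j z.2.
have HM : set0 `<=` @measurable _ Omega by [].
have Htheta' : cond_indep_laws P (set0 `|` events_of (stick_index N) psi) (atom_index N) theta (fun _ _ => P0).
  by rewrite set0U.
have := stick_mixture_integral (K := fun=> P0) (U := fun=> tt) (l := fun j => c j) (g := g) HM a0 Hpsi nN Q N' Htheta'.
rewrite integral_prob_cst => <- //.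
- apply: eq_integral => w _; rewrite big_split/=; congr (_ * _).
  (* Indices choosing the same atom are evaluated at one common theta_k, so they stay together under
     a single integral. *)
  rewrite (partition_big c xpredT)//=; apply: eq_bigr => k _.
  by rewrite /g; apply: eq_bigr => j /andP[_ /eqP ->].
- move=> k; apply: emeasurable_prod => j _.
  exact: (measurableT_comp (mf j)).
- by move=> k z; apply: prode_01 => j _.
Qed.

End representation.

Lemma measurable_integral_pprobability (g : T -> \bar R) :
  measurable_fun setT g -> (forall y, 0 <= g y) ->
  measurable_fun setT (fun G : pprobability T R => \int[G : probability T R]_y g y).
Proof.
move=> mg g0.
apply: (@measurable_fun_kernel_integral R _ (pprobability T R) _ T _ unit id (fun=> tt) (fun z => g z.2)) => //.
exact: (measurableT_comp mg).
Qed.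

Let X (G : pprobability T R) : \bar R := \prod_(j | Q j) \int[G : probability T R]_y f j y.

Let mX : measurable_fun setT X.
Proof.
apply: emeasurable_prod => j _; apply: measurable_integral_pprobability => // y.
by case/andP : (f01 j y).
Qed.

Let X01 G : 0 <= X G <= 1.
Proof. by apply: prode_01 => j _; exact: integral01. Qed.

Let DP_integral (M : probability (pprobability T R) R) d' (Omega : measurableType d')
  (P : probability Omega R) (G : {mfun Omega >-> pprobability T R}) :
  (forall A, measurable A -> M A = P (G @^-1` A)) ->
  \int[M]_H X H = \int[P]_w X (G w).
Proof.
move=> MP; rewrite (@eq_measure_integral _ _ _ setT (pushforward P G)).
  by rewrite ge0_integral_pushforward// => H _; case/andP : (X01 H).
by move=> A mA _; exact: MP.
Qed.

(** Almost surely the first n+1 weights are genuine stick products, also in a truncated process by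
    [nN], and the remaining atoms contribute nonnegative amounts. *)
Lemma dp_moment_le (N : option nat) (M : probability (pprobability T R) R) n :
  is_DP N a P0 M -> (forall k, (k < n.+1)%N -> stick_index N k) ->
  dp_moment n <= \int[M]_G \prod_(j | Q j) \int[G : probability T R]_y f j y.
Proof.
case=> d' [ Omega [P [psi [theta [G [Hpsi Htheta aeG MP]]]]]]; move=> nN.
rewrite -(truncated_mean_integral Hpsi Htheta nN) (DP_integral MP).
apply: ae_ge0_le_integral => //.
- by move=> w _; apply: prode_ge0 => j _; case/andP : (truncated_mean01 psi theta n w j).
- by apply: emeasurable_prod => j _; exact: measurable_truncated_mean.
- by move=> w _; case/andP : (X01 (G w)).
- exact: (measurableT_comp mX).
- have := ae_gem_weight a0 Hpsi; apply: filterS2 aeG => w Gw [w0 wE] _.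
  apply: prode_le => j _; have f0 y : 0 <= f j y by case/andP : (f01 j y).
  case/andP : (truncated_mean01 psi theta n w j) => -> _ /=.
  rewrite (integral_discrete_measure w0 Gw)//.
  have -> : truncated_mean psi theta n w j =
      \sum_(0 <= k < n.+1) ((gem_weight N (psi ^~ w) k)%:E * f j (theta k w)).
    by rewrite big_mkord; apply: eq_bigr => k _; rewrite wE//; exact: nN.
  by apply: nneseries_lim_ge => k _ _; rewrite mule_ge0// lee_fin.
Qed.

(** Without truncation the partial means increase to the full integrals, so monotone convergence
    applies to the product. *)
Lemma dp_moment_cvg (M : probability (pprobability T R) R) :
  is_DP None a P0 M ->
  dp_moment n @[n --> \oo] --> \int[M]_G \prod_(j | Q j) \int[G : probability T R]_y f j y.
Proof.
case=> d' [ Omega [P [psi [theta [G [Hpsi Htheta aeG MP]]]]]].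
have nN n k : (k < n.+1)%N -> stick_index None k by [].
rewrite (DP_integral MP).
have f0 j y : 0 <= f j y by case/andP : (f01 j y).
pose tm n w := \prod_(j | Q j) truncated_mean psi theta n w j.
have tm01 n w : 0 <= tm n w <= 1.
  by apply: prode_01 => j _; exact: truncated_mean01.
have mtm n : measurable_fun setT (tm n).
  by apply: emeasurable_prod => j _; exact: measurable_truncated_mean.
have E n : dp_moment n = \int[P]_w tm n w.
  by rewrite -(truncated_mean_integral Hpsi Htheta (nN n)).
under eq_fun do rewrite E.
have ndtm w : nondecreasing_seq (tm ^~ w).
  apply/nondecreasing_seqP => n; apply: prode_le => j _.
  case/andP : (truncated_mean01 psi theta n w j) => -> _ /=.
  rewrite /truncated_mean [leRHS]big_ord_recr /= leeDl// mule_ge0//.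
  by rewrite lee_fin; case/andP : (clip_stick01 psi w n.+1).
have -> : \int[P]_w X (G w) = \int[P]_w limn (tm ^~ w).
  apply: ge0_ae_eq_integral => //.
  - exact: (measurableT_comp mX).
  - apply: (emeasurable_fun_cvg tm) => // w _.
    exact: ereal_nondecreasing_is_cvgn.
  - by move=> w _; case/andP : (X01 (G w)).
  - move=> w _; apply: lime_ge; first exact: ereal_nondecreasing_is_cvgn.
    by apply: nearW => n; case/andP : (tm01 n w).
  - have := ae_gem_weight a0 Hpsi; apply: filterS2 aeG => w Gw [w0 wE] _.
    apply/esym/cvg_lim => //; apply: cvg_prode01 => [j n|j|j].
    + exact: truncated_mean01.
    + exact: integral01.
    + rewrite (integral_discrete_measure w0 Gw)//.
      have := @is_cvg_nneseries R (fun k => (gem_weight None (psi ^~ w) k)%:E * f j (theta k w)) xpredT 0.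
      move=> H; have {}H : cvgn (fun m => \sum_(0 <= k < m) (gem_weight None (psi ^~ w) k)%:E * f j (theta k w)).
        by apply: H => k _ _; rewrite mule_ge0// lee_fin.
      (* The truncated mean of index n has n+1 terms, hence the shift of the partial sums by one. *)
      have -> : (fun n => truncated_mean psi theta n w j) =
          [sequence (fun m => \sum_(0 <= k < m) (gem_weight None (psi ^~ w) k)%:E * f j (theta k w)) n.+1]_n.
        apply/funext => n; rewrite /truncated_mean /= big_mkord; apply: eq_bigr => k _.
        by rewrite -(wE k I).
      exact: (cvg_comp (addn 1) (fun m => \sum_(0 <= k < m) (gem_weight None (psi ^~ w) k)%:E * f j (theta k w)) (cvg_addnl 1) H).
apply: cvg_monotone_convergence => //.
- by move=> n w _; case/andP : (tm01 n w).
Qed.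

(** Both moments are limits of the same sequence [dp_moment], which involves only [a], [P0] and the
    functions. *)
Lemma is_DP_moment_unique (M1 M2 : probability (pprobability T R) R) :
  is_DP None a P0 M1 -> is_DP None a P0 M2 ->
  \int[M1]_G \prod_(j | Q j) \int[G : probability T R]_y f j y =
  \int[M2]_G \prod_(j | Q j) \int[G : probability T R]_y f j y.
Proof.
move=> /dp_moment_cvg H1 /dp_moment_cvg H2.
exact: (cvg_unique (@ereal_hausdorff R) H1 H2).
Qed.

End dirichlet_process.

(** * The ZIPLN kernel *)

Section zipln_kernel.
Context (R : realType).

Lemma std_normal_cdf01 (x : R) : 0 <= std_normal_cdf x <= 1.
Proof.
rewrite /std_normal_cdf fine_ge0//= -lee_fin fineK ?fin_num_measure//.
exact: probability_le1.
Qed.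

Lemma measurable_std_normal_cdf : measurable_fun setT (@std_normal_cdf R).
Proof.
apply: nondecreasing_measurable => // x y xy.
rewrite /std_normal_cdf fine_le ?fin_num_measure// le_measure ?inE//.
by apply: subset_itvl; rewrite bnd_simp.
Qed.

Lemma measurable_invr_ge0 d (X : measurableType d) (f : X -> R) :
  measurable_fun setT f -> (forall x, 0 <= f x) -> measurable_fun setT (fun x => (f x)^-1).
Proof.
move=> mf f0.
have -> : (fun x => (f x)^-1) = (fun x => f x `^ (-1)).
  by apply/funext => x; rewrite powR_inv1.
exact: (measurableT_comp (measurable_powR (-1)) mf).
Qed.

Lemma measurable_sqrtr : measurable_fun setT (@Num.sqrt R).
Proof. by apply: nondecreasing_measurable => // x y xy; exact: ler_wsqrtr. Qed.

Lemma measurable_fun_prod_nat d (X : measurableType d) d' (Y : measurableType d')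
  (f : X * nat -> Y) : (forall n, measurable_fun setT (fun x => f (x, n))) -> measurable_fun setT f.
Proof.
move=> mf _ B mB; rewrite setTI.
have -> : f @^-1` B = \bigcup_n (((fun x => f (x, n)) @^-1` B) `*` [set n]).
  apply/seteqP; split => [[x n] Bf|[x n] [m _ [/= Bf ->]]] //.
  by exists n.
apply: bigcup_measurable => n _; apply: measurableX => //.
by rewrite -[X in measurable X]setTI; exact: mf.
Qed.

(** The generating sets of the sigma-algebra on probabilities bound the mass of one set, so it
    suffices that each such mass be measurable in the parameters. This follows by Tonelli from joint
    measurability of the density, whose definition branches on a zero standard deviation. *)
Lemma measurable_normal_prob :
  measurable_fun setT (fun p : R * R => normal_prob p.1 p.2 : pprobability (measurableTypeR R) R).
Proof.
apply: (measurability (@pset _ _ _ : set (set (pprobability (measurableTypeR R) R)))) => //.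
move=> _ -[_ [r r01] [Ys mYs <-]] <-; apply: emeasurable_fun_infty_o => //=.
rewrite /normal_prob.
under eq_fun do rewrite integral_mkcond.
have m1 : measurable_fun setT (fun z : (R * R) * R => z.1.1).
  by apply: (measurableT_comp measurable_fst measurable_fst).
have m2 : measurable_fun setT (fun z : (R * R) * R => z.1.2).
  by apply: (measurableT_comp measurable_snd measurable_fst).
have m3 : measurable_fun setT (fun z : (R * R) * R => z.2).
  exact: measurable_snd.
pose f (z : (R * R) * R) := (\1_Ys z.2 * normal_pdf z.1.1 z.1.2 z.2)%:E.
have mf : measurable_fun setT f.
  apply/measurable_EFinP; apply: measurable_funM.
    exact: (measurableT_comp (measurable_indic mYs)).
  rewrite /normal_pdf; apply: measurable_fun_if => //.
  - by apply: measurable_fun_eqr => //.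
  - by apply: measurable_funTS; exact: (measurableT_comp (measurable_indic _)).
  - apply: measurable_funTS; apply: measurable_funM.
      apply: measurable_invr_ge0 => //.
      apply: (measurableT_comp measurable_sqrtr).
      rewrite (_ : (fun x => _) = (fun z : R * R * R => z.1.2 ^+ 2 * (pi *+ 2))); last first.
        by apply/funext => z; rewrite [RHS]mulrnAr.
      by apply: measurable_funM => //; exact: measurable_funX.
    rewrite /normal_fun; apply: measurableT_comp => //; apply: measurable_funM.
      apply: measurableT_comp => //; apply: measurable_funX; exact: measurable_funB.
    apply: measurable_invr_ge0; last by move=> z; rewrite mulrn_wge0// sqr_ge0.
    rewrite (_ : (fun x => _) = (fun z : R * R * R => z.1.2 ^+ 2 * 2)); last first.
      by apply/funext => z; rewrite mulr_natr.
    by apply: measurable_funM => //; exact: measurable_funX.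
have f0 z : (0 <= f z)%E by rewrite lee_fin mulr_ge0// normal_pdf_ge0.
have := @measurable_fun_fubini_tonelli_F _ _ _ _ R (@lebesgue_measure R) f mf f0.
congr measurable_fun; apply/funext => p; apply: eq_integral => x _.
by rewrite epatch_indic /f /= EFinM muleC.
Qed.

Lemma zero_prob01 (l0 l1 : R) y : 0 <= zero_prob l0 l1 y <= 1.
Proof. exact: std_normal_cdf01. Qed.

Local Open Scope ereal_scope.

Definition zip (l0 l1 : R) (B : set nat) (y : nat) : \bar R :=
  (zero_prob l0 l1 y)%:E * \d_0%N B + (1 - zero_prob l0 l1 y)%:E * \d_y B.

Lemma zip01 (l0 l1 : R) B y : 0 <= zip l0 l1 B y <= 1.
Proof.
have /andP[p0 p1] := zero_prob01 l0 l1 y.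
have q0 : (0 <= 1 - zero_prob l0 l1 y)%R by rewrite subr_ge0.
rewrite adde_ge0 ?mule_ge0//=.
apply: (@le_trans _ _ ((zero_prob l0 l1 y)%:E + (1 - zero_prob l0 l1 y)%:E)); last first.
  by rewrite -EFinD addrC subrK.
by apply: leeD; rewrite -[leRHS]mule1 lee_wpmul2l// probability_le1.
Qed.

Let Q (X : Type) (m sd : X -> R) (x : X) : pprobability (measurableTypeR R) R :=
  normal_prob (m x) (sd x).

Let Po (X : Type) (r : X -> R) (x : X) : pprobability nat R := poisson_prob (r x) 0%N.

Let measurable_Q d (X : measurableType d) (m sd : X -> R) :
  measurable_fun setT m -> measurable_fun setT sd -> measurable_fun setT (Q m sd).
Proof.
move=> mm msd.
by apply: (measurableT_comp measurable_normal_prob (measurable_fun_pair mm msd)).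
Qed.

Let measurable_Po d (X : measurableType d) (r : X -> R) :
  measurable_fun setT r -> measurable_fun setT (Po r).
Proof. by move=> mr; exact: (measurableT_comp (measurable_poisson_prob 0%N) mr). Qed.

Let measurable_zip d (X : measurableType d) (l0 l1 : X -> R) (B : set nat) y :
  measurable_fun setT l0 -> measurable_fun setT l1 ->
  measurable_fun setT (fun x => zip (l0 x) (l1 x) B y).
Proof.
move=> ml0 ml1.
have mz : measurable_fun setT (fun x => zero_prob (l0 x) (l1 x) y).
  apply: (measurableT_comp measurable_std_normal_cdf).
  by apply: measurable_funD => //; exact: measurable_funM.
apply: emeasurable_funD; apply: emeasurable_funM => //.
  exact/measurable_EFinP.
by apply/measurable_EFinP; exact: measurable_funB.
Qed.

Let measurable_poisson_zip d (X : measurableType d) (l0 l1 r : X -> R) (B : set nat) :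
  measurable_fun setT l0 -> measurable_fun setT l1 -> measurable_fun setT r ->
  measurable_fun setT (fun x => \int[poisson_prob (r x) 0%N]_y zip (l0 x) (l1 x) B y).
Proof.
move=> ml0 ml1 mr.
apply: (@measurable_fun_kernel_integral R _ X _ nat _ X (Po r) id
  (fun z => zip (l0 z.1) (l1 z.1) B z.2)) => //.
- exact: measurable_Po.
- by apply: measurable_fun_prod_nat => n; exact: measurable_zip.
- by move=> z; case/andP : (zip01 (l0 z.1) (l1 z.1) B z.2).
Qed.

Let poisson_zip01 (l0 l1 r : R) (B : set nat) :
  0 <= \int[poisson_prob r 0%N]_y zip l0 l1 B y <= 1.
Proof. by apply: integral01 => // y; exact: zip01. Qed.

Lemma measurable_zipln d (X : measurableType d) (l0 l1 eta sg : X -> R) (s : R) (B : set nat) :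
  measurable_fun setT l0 -> measurable_fun setT l1 -> measurable_fun setT eta ->
  measurable_fun setT sg ->
  measurable_fun setT (fun x => zipln (l0 x) (l1 x) s (eta x) (sg x) B).
Proof.
move=> ml0 ml1 meta msg.
apply: (@measurable_fun_kernel_integral R _ X _ (measurableTypeR R) _ X (Q eta (Num.sqrt \o sg)) id
  (fun z => \int[poisson_prob (s * expR z.2) 0%N]_y zip (l0 z.1) (l1 z.1) B y)) => //.
- by apply: measurable_Q => //; exact: (measurableT_comp measurable_sqrtr).
- apply: (@measurable_poisson_zip _ _ (fun z => l0 z.1) (fun z => l1 z.1) (fun z => s * expR z.2)%R).
  + exact: (measurableT_comp ml0).
  + exact: (measurableT_comp ml1).
  + apply: measurable_funM => //.
    exact: (measurableT_comp (@measurable_expR R) measurable_snd).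
- by move=> z; case/andP : (poisson_zip01 (l0 z.1) (l1 z.1) (s * expR z.2) B).
Qed.

Let measurable_inner (l0 l1 s : R) B :
  measurable_fun [set: measurableTypeR R] (fun th : R => \int[poisson_prob (s * expR th) 0%N]_y zip l0 l1 B y).
Proof.
apply: (@measurable_poisson_zip _ _ (fun=> l0) (fun=> l1) (fun th => s * expR th)%R) => //.
by apply: measurable_funM => //; exact: measurable_expR.
Qed.

Lemma zipln01 (l0 l1 s eta sg : R) B : 0 <= zipln l0 l1 s eta sg B <= 1.
Proof.
apply: integral01 => [|th]; first exact: measurable_inner.
exact: poisson_zip01.
Qed.

(** The sum over values passes under the normal and Poisson integrals, leaving a convex combination
    of two Dirac masses. *)
Lemma zipln_sum1 (l0 l1 s eta sg : R) :
  \sum_(0 <= v <oo) zipln l0 l1 s eta sg [set v] = 1.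
Proof.
rewrite /zipln -integral_nneseries//; first last.
- by move=> v th _; case/andP : (poisson_zip01 l0 l1 (s * expR th) [set v]).
- by move=> v; exact: measurable_inner.
rewrite -[RHS](integral_prob_cst (normal_prob eta (Num.sqrt sg))); apply: eq_integral => th _.
rewrite -integral_nneseries//; last by move=> v y _; case/andP : (zip01 l0 l1 [set v] y).
rewrite -[RHS](integral_prob_cst (poisson_prob (s * expR th) 0%N)); apply: eq_integral => y _.
have dS (x : nat) : \sum_(0 <= v <oo) \d_x [set v] = 1 :> \bar R.
  rewrite (nneseriesD1 (n := x))// eseries0 ?adde0; first by rewrite diracE mem_set.
  move=> i _ /= ix; rewrite diracE memNset//= => xi.
  by move: ix; rewrite xi eqxx.
have /andP[p0 p1] := zero_prob01 l0 l1 y.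
have q0 : (0 <= 1 - zero_prob l0 l1 y)%R by rewrite subr_ge0.
rewrite nneseriesD; try by move=> *; rewrite mule_ge0.
rewrite !nneseriesZl//.
by rewrite !dS !mule1 -EFinD addrC subrK.
Qed.

End zipln_kernel.

(** * Summation over the data *)

Section countable_sums.
Local Open Scope ereal_scope.
Context (R : realType).

Lemma sum_le_esum (A : finType) (T : choiceType) (e : A -> T) (a : T -> \bar R) :
  injective e -> \sum_(i : A) a (e i) <= \esum_(x in [set: T]) a x.
Proof.
move=> inje; apply: esum_ge; exists [set` map e (enum A)].
  by split => //; exact: finite_seq.
rewrite -fsbig_seq; last by rewrite map_inj_uniq// enum_uniq.
by rewrite big_map big_enum.
Qed.

(** Turns a supremum of finite sums into a series, to which exchange with integrals applies; numbers
    that code no element contribute the default 0. *)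
Lemma esum_countE (T : countType) (a : T -> \bar R) : (forall x, 0 <= a x) ->
  \esum_(x in [set: T]) a x = \sum_(0 <= n <oo) oapp a 0 (pickle_inv n).
Proof.
move=> a0; rewrite nneseries_esumT; last by move=> n; case: pickle_inv => //=.
rewrite [RHS](_ : _ = \esum_(n in range (@choice.pickle T)) oapp a 0 (pickle_inv n)).
  rewrite esum_image; last by move=> x y _ _ /(pcan_inj choice.pickleK).
  by apply: eq_esum => x _; rewrite pickleK_inv.
rewrite [RHS]esum_mkcond; apply: eq_esum => n _.
case: ifPn => //; rewrite notin_setE => nr.
have := @pickle_invK T n; case: pickle_inv => //= x xn; exfalso; apply: nr.
by exists x.
Qed.

Lemma ge0_integral_esum d (S : measurableType d) (mu : {measure set S -> \bar R})
    (T : countType) (f : T -> S -> \bar R) :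
  (forall x, measurable_fun setT (f x)) -> (forall x y, 0 <= f x y) ->
  \int[mu]_y (\esum_(x in [set: T]) f x y) = \esum_(x in [set: T]) \int[mu]_y f x y.
Proof.
move=> mf f0.
under eq_integral do rewrite esum_countE//.
rewrite integral_nneseries//; first last.
- by move=> n y _; case: pickle_inv => //=.
- by move=> n; case: pickle_inv => //=.
rewrite esum_countE; last by move=> x; apply: integral_ge0.
by apply: eq_eseriesr => n _; case: pickle_inv => //=; rewrite integral0.
Qed.

Lemma measurable_esum d (S : measurableType d) (T : countType) (f : T -> S -> \bar R) :
  (forall x, measurable_fun setT (f x)) -> (forall x y, 0 <= f x y) ->
  measurable_fun setT (fun y => \esum_(x in [set: T]) f x y).
Proof.
move=> mf f0; under eq_fun do rewrite esum_countE//.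
apply: ge0_emeasurable_sum => [n y _ _|n _]; by case: pickle_inv => //=.
Qed.

(** Over the finite box of arrays with entries at most N the sum factors into partial sums, and
    their product tends to 1. *)
Lemma esum_prod_ge1 (J : finType) (p : J -> nat -> \bar R) :
  (forall j v, 0 <= p j v) -> (forall j, \sum_(0 <= v <oo) p j v = 1) ->
  1 <= \esum_(x in [set: {ffun J -> nat}]) \prod_j p j (x j).
Proof.
move=> p0 p1.
have ps01 j N : 0 <= \sum_(v < N.+1) p j v <= 1.
  apply/andP; split; first by apply: sume_ge0.
  rewrite -(p1 j); have := @nneseries_lim_ge R (p j) xpredT 0 N.+1 (fun k _ _ => p0 j k).
  by rewrite big_mkord.
have p01 j v : 0 <= p j v <= 1.
  rewrite p0 /=; have /andP[_] := ps01 j v; apply: le_trans.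
  by rewrite big_ord_recr /= leeDr// sume_ge0.
have cvg1 : (fun N => \prod_j \sum_(v < N.+1) p j v) @ \oo --> (1 : \bar R).
  have E1 : \prod_(j : J) (1 : \bar R) = 1 by rewrite big1.
  rewrite -[X in _ --> X]E1.
  apply: cvg_prode01 => [//|_|j]; first by rewrite lee01 lexx.
  rewrite -(p1 j).
  have H : cvgn (fun m => \sum_(0 <= k < m) p j k) by apply: is_cvg_nneseries => k _ _; exact: p0.
  have -> : (fun m => \sum_(v < m.+1) p j v) = (fun m => \sum_(0 <= k < m) p j k) \o addn 1.
    by apply/funext => m /=; rewrite big_mkord.
  exact: (cvg_comp (addn 1) (fun m => \sum_(0 <= k < m) p j k) (cvg_addnl 1) H).
rewrite -[leLHS](cvg_lim (@ereal_hausdorff R) cvg1).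
apply: lime_le; first by apply/cvg_ex; exists 1.
apply: nearW => N.
rewrite (prode_sume_distr ord0)//.
apply: le_trans (sum_le_esum (e := fun x : {ffun J -> 'I_N.+1} => [ffun j => val (x j)]) _ _).
  rewrite [leRHS]big_mkcond /= [leLHS]big_mkcond; apply: lee_sum => x _.
  under [X in _ <= X]eq_bigr do rewrite ffunE.
  by case: ifPn => // _; apply: prode_ge0.
by move=> x y /ffunP xy; apply/ffunP => j; have := xy j; rewrite !ffunE => /val_inj.
Qed.

(** If every block has a fixed point y, the sum is that of a product of mass functions. The fixed
    points are then replaced by integrals against [G] one block at a time. *)
Lemma esum_prod_integral_ge1 d (Y : measurableType d) (G : probability Y R) (J B : finType)
    (blk : J -> B) (z : J -> nat -> Y -> \bar R) :
  (forall j v, measurable_fun setT (z j v)) -> (forall j v y, 0 <= z j v y <= 1) ->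
  (forall j y, \sum_(0 <= v <oo) z j v y = 1) ->
  1 <= \esum_(x in [set: {ffun J -> nat}])
         \prod_b \int[G]_y \prod_(j | blk j == b) z j (x j) y.
Proof.
move=> mz z01 z1.
have z0 j v y : 0 <= z j v y by case/andP : (z01 j v y).
pose F (x : {ffun J -> nat}) b y := \prod_(j | blk j == b) z j (x j) y.
have F0 x b y : 0 <= F x b y by apply: prode_ge0.
have mF x b : measurable_fun setT (F x b) by apply: emeasurable_prod.
have IF01 x b : 0 <= \int[G]_y F x b y <= 1.
  by apply: integral01 => // y; apply: prode_01.
(* Blocks in [s] are already integrated; each other block b is still evaluated at an arbitrary point
   [y b]. *)
have main (s : seq B) : uniq s -> forall y : B -> Y,
    1 <= \esum_(x in [set: {ffun J -> nat}])
     (\prod_(b <- s) \int[G]_u F x b u * \prod_(b | b \notin s) F x b (y b)).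
  elim: s => [_ y|b0 s IH /= /andP[b0s us] y].
    apply: le_trans (esum_prod_ge1 (p := fun j v => z j v (y (blk j))) _ _) _ => //.
    apply: le_esum => x _; rewrite big_nil mul1e.
    rewrite (partition_big blk xpredT)//=; apply: prode_le => b _.
    rewrite prode_ge0//=; under eq_bigr => j /eqP -> do over.
    by rewrite lexx.
  (* Everything except the block [b0], constant with respect to the variable to be integrated. *)
  pose c (x : {ffun J -> nat}) := \prod_(b <- s) \int[G]_u F x b u *
     \prod_(b | b \notin b0 :: s) F x b (y b).
  have c01 x : 0 <= c x <= 1 by apply: mule_le1; apply: prode_01 => b _ //; exact: prode_01.
  have cE x : \prod_(b <- b0 :: s) \int[G]_u F x b u * \prod_(b | b \notin b0 :: s) F x b (y b) =
      \int[G]_u (c x * F x b0 u).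
    rewrite ge0_integralZl//; last by case/andP : (c01 x).
    by rewrite big_cons -muleA muleC.
  under eq_esum do rewrite cE.
  rewrite -ge0_integral_esum; first last.
  - by move=> x u; rewrite mule_ge0//; case/andP : (c01 x).
  - by move=> x; apply: emeasurable_funM => //; exact: measurable_cst.
  rewrite -[leLHS](integral_prob_cst G); apply: ge0_le_integral => //.
  - apply: measurable_esum => [x|x u]; first by apply: emeasurable_funM => //; exact: measurable_cst.
    by rewrite mule_ge0//; case/andP : (c01 x).
  - move=> u _; apply: le_trans (IH us (fun b => if b == b0 then u else y b)) _.
    apply: le_esum => x _; rewrite /c -muleA lee_wpmul2l//.
      by apply: prode_ge0 => b _; case/andP : (IF01 x b).
    rewrite (bigD1 b0)//= eqxx muleC lee_wpmul2r//.
    rewrite [leRHS](eq_bigl (fun b => (b \notin s) && (b != b0))); last first.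
      by move=> b; rewrite in_cons negb_or andbC.
    by apply: prode_le => b /andP[_ /negbTE ->]; rewrite F0 lexx.
have := main (enum B) (enum_uniq _) (fun=> point).
congr (_ <= _); apply: eq_esum => x _.
rewrite [X in _ * X]big_pred0 ?mule1 ?big_enum//.
by move=> b; rewrite mem_enum.
Qed.

End countable_sums.

(** * The lower bound for one model *)

Section borel_coordinates.
Context (R : realType) (D : nat).

Lemma measurable_coord (g : 'I_D) :
  measurable_fun [set: borel_space R D] (fun y : borel_space R D => (y : 'rV[R]_D) ord0 g).
Proof.
apply: (measurability _ (RGenOInfty.measurableE R)) => _ [_ [x ->] <-].
rewrite setTI; apply: sub_sigma_algebra.
move: (@coord_continuous R 1 D ord0 g) => /continuousP; apply.
rewrite set_itvE; exact: open_gt.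
Qed.

End borel_coordinates.

Section sub_additivity.
Local Open Scope ereal_scope.

Lemma sum_measure_le (R : realType) d (T : measurableType d) (mu : {measure set T -> \bar R})
    (A : finType) (F : A -> set T) (E : set T) :
  measurable E -> (forall i, measurable (F i)) -> trivIset setT F -> (forall i, F i `<=` E) ->
  \sum_i mu (F i) <= mu E.
Proof.
move=> mE mF tF FE.
have -> : \sum_i mu (F i) = mu (\bigcup_(i in [set` enum A]) F i).
  rewrite measure_fin_bigcup//; last exact: sub_trivIset tF.
  by rewrite -fsbig_seq ?enum_uniq// big_enum.
apply: le_measure; rewrite ?inE//; last by move=> w [i _ /FE].
by apply: fin_bigcup_measurable.
Qed.

End sub_additivity.

Lemma measurable_fun_nat_index d d' (X : measurableType d) (Y : measurableType d')
  (f : nat -> X -> Y) (g : X -> nat) : (forall l, measurable_fun setT (f l)) ->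
  measurable_fun setT g -> measurable_fun setT (fun x => f (g x) x).
Proof.
move=> mf mg.
have H : measurable_fun setT (fun z : X * nat => f z.2 z.1) by exact: measurable_fun_prod_nat.
exact: (measurableT_comp H (measurable_fun_pair (@measurable_id _ _ _) mg)).
Qed.

Section model_lower_bound.
Local Open Scope ereal_scope.
Context (R : realType) (m : nat) (n : 'I_m -> nat) (D : nat) (nu gamma : R)
  (s : cell n -> R) (pr : prior R D).
Hypotheses (nu0 : (0 < nu)%R) (gamma0 : (0 < gamma)%R).

Local Notation Y := (borel_space R D).

(** The label is an argument and not read from the sample: once labels are fixed, the law of a count
    is a function of parameters and cell effect alone. *)
Definition count_law (cg : cell n * 'I_D) (l : nat) (v : nat) (z : par_space pr * Y) : \bar R :=
  zipln (lambda0 pr cg.2 z.1) (lambda1 pr cg.2 z.1) (s cg.1)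
    ((z.2 : 'rV[R]_D) ord0 cg.2 + beta pr cg.2 l z.1) (sigma2 pr cg.2 z.1) [set v].

Definition cell_law (x : data n D) (l : nat) (c : cell n) (z : par_space pr * Y) : \bar R :=
  \prod_g count_law (c, g) l (x (c, g)) z.

Lemma count_law01 cg l v z : 0 <= count_law cg l v z <= 1.
Proof. exact: zipln01. Qed.

Lemma measurable_count_law cg l v : measurable_fun setT (count_law cg l v).
Proof.
have mf (f : {mfun par_space pr >-> R}) : measurable_fun setT (fun z : par_space pr * Y => f z.1).
  exact: (measurableT_comp (measurable_funPT f) measurable_fst).
apply: measurable_zipln; [exact: mf|exact: mf| |exact: mf].
apply: measurable_funD; last exact: mf.
exact: (measurableT_comp (measurable_coord cg.2) measurable_snd).
Qed.

Lemma cell_law01 x l c z : 0 <= cell_law x l c z <= 1.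
Proof. by apply: prode_01 => g _; exact: count_law01. Qed.

Lemma measurable_cell_law x l c : measurable_fun setT (cell_law x l c).
Proof. by apply: emeasurable_prod => g _; exact: measurable_count_law. Qed.

Section one_model.
Variables (Lo Ko : option nat) (M : scsc_model nu gamma s pr Lo Ko).
Variables (N k0 : nat).
Hypothesis hL : forall k, (k < N.+1)%N -> stick_index Lo k.
Hypothesis hK : forall k, (k < k0.+1)%N -> stick_index Ko k.

Local Notation P := (sample_law M).
Local Notation h1 := (@hist1 R m n D nu gamma s pr Lo Ko M).
Local Notation h2 := (@hist2 R m n D nu gamma s pr Lo Ko M).
Local Notation h3 := (@hist3 R m n D nu gamma s pr Lo Ko M).
Local Notation h4 := (@hist4 R m n D nu gamma s pr Lo Ko M).
Local Notation h5 := (@hist5 R m n D nu gamma s pr Lo Ko M).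
Local Notation h6 := (@hist6 R m n D nu gamma s pr Lo Ko M).

Let hist1M : h1 `<=` measurable.
Proof. by apply: events_of1_measurable; exact: measurable_funPT. Qed.
Let hist2M : h2 `<=` measurable.
Proof. by rewrite subUset; split => //; apply: events_of1_measurable; exact: measurable_funPT. Qed.
Let hist3M : h3 `<=` measurable.
Proof. by rewrite subUset; split => //; apply: events_of_measurable => i; exact: measurable_funPT. Qed.
Let hist4M : h4 `<=` measurable.
Proof. by rewrite subUset; split => //; apply: events_of_measurable => i; exact: measurable_funPT. Qed.
Let hist5M : h5 `<=` measurable.
Proof. by rewrite subUset; split => //; apply: events_of_measurable => i; exact: measurable_funPT. Qed.
Let h12 : h1 `<=` h2. Proof. by move=> A; left. Qed.
Let h23 : h2 `<=` h3. Proof. by move=> A; left. Qed.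
Let h34 : h3 `<=` h4. Proof. by move=> A; left. Qed.
Let h45 : h4 `<=` h5. Proof. by move=> A; left. Qed.
Let h56 : h5 `<=` h6. Proof. by move=> A; left. Qed.

Definition data_event (x : data n D) : set (sample_space M) :=
  [set w | forall cg, count_data M cg w = x cg].

Definition label_event (l : {ffun 'I_m -> 'I_N.+1}) : set (sample_space M) :=
  [set w | forall j, sub_label M j w = l j].

Let measurable_par1 : measurable_fun [set: g_sigma_algebraType (h1)] (par M).
Proof. exact: measurable_fun_events. Qed.

Let measurable_label5 j : measurable_fun [set: g_sigma_algebraType (h5)] (sub_label M j).
Proof. by apply: measurable_fun_events => A HA; right; exists j. Qed.

Lemma data_eventE x : data_event x =
  \bigcap_(cg in [set` enum {: cell n * 'I_D}]) (count_data M cg @^-1` [set x cg]).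
Proof.
apply/seteqP; split => w /= H cg; first by move=> _; exact: H.
by apply: H; rewrite /= mem_enum.
Qed.

Lemma label_eventE l : label_event l =
  \bigcap_(j in [set` enum 'I_m]) (sub_label M j @^-1` [set (l j : nat)]).
Proof.
apply/seteqP; split => w /= H j; first by move=> _; exact: H.
by apply: H; rewrite /= mem_enum.
Qed.

Lemma measurable_label_event5 l : <<s h5 >> (label_event l).
Proof.
rewrite label_eventE.
apply: (@fin_bigcap_measurable _ (g_sigma_algebraType (h5))) => // j _.
rewrite -[X in measurable X]setTI; exact: measurable_label5.
Qed.

Lemma measurable_label_event l : measurable (label_event l).
Proof.
have : <<s h5 >> `<=` measurable.
  by apply: smallest_sub => //; exact: sigma_algebra_measurable.
by apply; exact: measurable_label_event5.
Qed.

Lemma measurable_data_event x : measurable (data_event x).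
Proof.
rewrite data_eventE; apply: fin_bigcap_measurable => // cg _.
by rewrite -[X in measurable X]setTI; exact: measurable_funPT.
Qed.

(* Only the labels below N.+1 are kept. *)
Lemma data_event_ge x : \sum_(l : {ffun 'I_m -> 'I_N.+1}) P (label_event l `&` data_event x) <= P (data_event x).
Proof.
apply: sum_measure_le => //.
- exact: measurable_data_event.
- by move=> l; apply: measurableI; [exact: measurable_label_event|exact: measurable_data_event].
- move=> l1 l2 _ _ [w [[H1 _] [H2 _]]].
  by apply/ffunP => j; apply: val_inj => /=; rewrite -H1 -H2.
Qed.

Lemma label_data_event x (l : {ffun 'I_m -> 'I_N.+1}) :
  P (label_event l `&` data_event x) =
  \int[P]_w ((\1_(label_event l) w)%:E * \prod_c cell_law x (l (tag c)) c (par M w, cell_effect M c w)).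
Proof.
have A6 : <<s h6 >> (label_event l).
  have : <<s h5 >> `<=` <<s h6 >>; last by apply; exact: measurable_label_event5.
  apply: smallest_sub; first exact: smallest_sigma_algebra.
  by apply: (subset_trans h56); exact: sub_gen_smallest.
rewrite data_eventE.
rewrite (cond_indep_laws_seq (@count_data_spec R m n D nu gamma s pr Lo Ko M) A6 (enum_uniq _) _ (B := fun cg => [set x cg]))//.
rewrite integral_mkcond; apply: eq_integral => w _.
rewrite epatch_indic /= muleC.
have [wA|wA] := boolP (w \in label_event l); last by rewrite indicE (negbTE wA) !mul0e.
move/set_mem : wA => wA; congr (_ * _).
rewrite big_enum /= pair_bigA /=; apply: eq_bigr => -[c g] _.
by rewrite /count_law /= wA.
Qed.

Let effect_kernel (c : cell n) (w : sample_space M) : pprobability Y R :=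
  sub_measure M (sub_label M (tag c) w) w.

(** The kernel of a cell effect has a random index, its subject's label. On [label_event l] this
    index is constant, so the subgroup measure of a fixed label appears. *)
Lemma label_effect_integral x (l : {ffun 'I_m -> 'I_N.+1}) :
  \int[P]_w ((\1_(label_event l) w)%:E * \prod_c cell_law x (l (tag c)) c (par M w, cell_effect M c w)) =
  \int[P]_w ((\1_(label_event l) w)%:E *
    \prod_c \int[sub_measure M (l (tag c)) w : probability Y R]_y cell_law x (l (tag c)) c (par M w, y)).
Proof.
have mK c : measurable_fun setT (effect_kernel c).
  apply: (@measurable_fun_nat_index _ _ _ _ (fun l w => sub_measure M l w)) => [k|];
    exact: measurable_funPT.
have mpar5 : measurable_fun [set: g_sigma_algebraType h5] (par M).
  apply: measurable_fun_sigmaS measurable_par1.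
  exact: (subset_trans h12 (subset_trans h23 (subset_trans h34 h45))).
have mZ : measurable_fun [set: g_sigma_algebraType h5] (fun w => (\1_(label_event l) w : R)%:E).
  by apply/measurable_EFinP; apply: measurable_indic; exact: measurable_label_event5.
have := cond_indep_integral hist5M (W := fun c => cell_effect M c) _
  (@cell_effect_spec R m n D nu gamma s pr Lo Ko M) (K := effect_kernel) mK _ (U := par M)
  (Z := fun w => (\1_(label_event l) w)%:E) (s := index_enum (cell n))
  (g := fun c => cell_law x (l (tag c)) c) mpar5 mZ.
move=> ->.
- apply: eq_integral => w _.
  have [wA|wA] := boolP (w \in label_event l); last by rewrite indicE (negbTE wA) !mul0e.
  move/set_mem : wA => wA; congr (_ * _).
  by apply: eq_bigr => c _; rewrite /effect_kernel wA.
- by move=> c; exact: measurable_funPT.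
- by [].
- by move=> w; exact: indic01.
- exact: index_enum_uniq.
- by [].
- by move=> c; exact: measurable_cell_law.
- by move=> c z; exact: cell_law01.
Qed.

Let sub_measure_stick l : (l < N.+1)%N -> atom_index Lo l.
Proof. by move=> /hL; case: (Lo) => //= N'; exact: ltnW. Qed.

Let gem_weightE (psi : nat -> R) l : (l < N.+1)%N -> gem_weight Lo psi l = stick psi l.
Proof. by move=> /hL; rewrite /gem_weight; case: (Lo) => //= N' ->. Qed.

Let discrete_measure_set1 (w : nat -> R) l :
  discrete_measure w id [set l] = (w l)%:E.
Proof.
apply/cvg_lim => //; apply: cvg_near_cst; exists l.+1 => // k /= lk.
rewrite (bigD1_seq l) ?mem_index_iota ?iota_uniq//=.
rewrite diracE mem_set// mule1 big1 ?adde0// => i il.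
rewrite diracE memNset ?mule0// => /= E.
by rewrite E eqxx in il.
Qed.

Definition mixed_mass x (l : {ffun 'I_m -> 'I_N.+1}) (k : nat) (z : par_space pr * pprobability Y R) :=
  \prod_(c | l (tag c) == k :> nat) \int[z.2 : probability Y R]_y cell_law x k c (z.1, y).

Lemma mixed_mass01 x l k z : 0 <= mixed_mass x l k z <= 1.
Proof.
apply: prode_01 => c _; apply: integral01; last by move=> y; exact: cell_law01.
by apply: (measurableT_comp (measurable_cell_law _ _ _)); exact: measurable_pair1.
Qed.

Lemma measurable_mixed_mass x l k : measurable_fun setT (mixed_mass x l k).
Proof.
apply: emeasurable_prod => c _.
apply: (@measurable_fun_kernel_integral R _ _ _ Y _ (par_space pr) snd fst (cell_law x k c)) => //.
- exact: measurable_cell_law.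
- by move=> z; case/andP : (cell_law01 x k c z).
Qed.

Lemma prod_mixed_mass x (l : {ffun 'I_m -> 'I_N.+1}) w :
  \prod_c \int[sub_measure M (l (tag c)) w : probability Y R]_y cell_law x (l (tag c)) c (par M w, y) =
  \prod_(k < N.+1) mixed_mass x l k (par M w, sub_measure M k w).
Proof.
rewrite (partition_big (fun c => l (tag c)) xpredT); last by [].
apply: eq_bigr => k _; by apply: eq_bigr => c /eqP <-.
Qed.

(** The subgroup measures are known before the labels are drawn, so averaging over labels replaces
    the event by its conditional probability, a product of sub weights. *)
Lemma label_integral x (l : {ffun 'I_m -> 'I_N.+1}) :
  \int[P]_w ((\1_(label_event l) w)%:E *
    \prod_(k < N.+1) mixed_mass x l k (par M w, sub_measure M k w)) =
  \int[P]_w (\prod_j (clip_stick (sub_stick M) w (l j))%:E *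
    \prod_(k < N.+1) mixed_mass x l k (par M w, sub_measure M k w)).
Proof.
have mpar4 : measurable_fun [set: g_sigma_algebraType h4] (par M).
  apply: measurable_fun_sigmaS measurable_par1.
  exact: (subset_trans h12 (subset_trans h23 h34)).
have mZ : measurable_fun [set: g_sigma_algebraType h4]
    (fun w => \prod_(k < N.+1) mixed_mass x l k (par M w, sub_measure M k w)).
  apply: emeasurable_prod => k _.
  apply: (measurableT_comp (measurable_mixed_mass x l k)).
  apply: measurable_fun_pair => //.
  apply: measurable_fun_events => A HA; right; exists k => //.
  exact: sub_measure_stick.
have gE w (j : 'I_m) : gem_weight Lo (sub_stick M ^~ w) (l j) = stick (sub_stick M ^~ w) (l j).
  exact: gem_weightE.
have kE (j : 'I_m) w : discrete_measure (fun k => gem_weight Lo (sub_stick M ^~ w) k) id [set (l j : nat)] =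
    (stick (sub_stick M ^~ w) (l j))%:E.
  by rewrite discrete_measure_set1 -gE.
have := cond_indep_sets hist4M (W := fun j => sub_label M j) _
  (@sub_label_spec R m n D nu gamma s pr Lo Ko M)
  (Z := fun w => \prod_(k < N.+1) mixed_mass x l k (par M w, sub_measure M k w))
  (s := index_enum 'I_m) (B := fun j => [set (l j : nat)])
  (h := fun w => \prod_j (clip_stick (sub_stick M) w (l j))%:E).
move=> <-.
- apply: eq_integral => w _; congr (_ * _).
  rewrite prode_indic label_eventE bigcap_seq; congr (\1__ _)%:E.
  by rewrite big_enum.
- by move=> j; exact: measurable_funPT.
- exact: mZ.
- by move=> w; apply: prode_ge0 => k _; case/andP : (mixed_mass01 x l k (par M w, sub_measure M k w)).
- exact: index_enum_uniq.
- by [].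
- by [].
- by move=> w; apply: prode_01 => j _; rewrite !lee_fin clip_stick01.
- apply: emeasurable_prod => j _; apply/measurable_EFinP.
  by apply: (@measurable_clip_stick _ _ _ (sub_stick M) _ _ id) => t _; exact: measurable_funPT.
- move=> j _.
  rewrite (_ : (fun w => _) = fun w => (stick (sub_stick M ^~ w) (l j))%:E); last first.
    by apply/funext => w; exact: kE.
  apply/measurable_EFinP; rewrite /stick; apply: measurable_funM; first exact: measurable_funPT.
  apply: measurable_prod => t _; apply: measurable_funB => //; exact: measurable_funPT.
(* The exact label probabilities are unclipped stick products; they agree with the clipped ones
   almost surely. *)
- have := ae_gem_weight nu0 (@sub_stick_spec R m n D nu gamma s pr Lo Ko M).
  apply: filterS => w [_ wE]; apply: eq_bigr => j _.
  by rewrite -wE ?gE; [exact: kE|apply: hL].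
Qed.

Definition mixed_moment x (l : {ffun 'I_m -> 'I_N.+1}) (k : nat) (z : par_space pr * pprobability Y R) :=
  dp_moment (z.2 : probability Y R) gamma (fun c : cell n => l (tag c) == k :> nat)
    (fun c y => cell_law x k c (z.1, y)) k0.

Let measurable_cell_law_pair x k c t : measurable_fun setT (fun y : Y => cell_law x k c (t, y)).
Proof. by apply: (measurableT_comp (measurable_cell_law _ _ _)); exact: measurable_pair1. Qed.

Lemma mixed_moment_ge0 x l k z : 0 <= mixed_moment x l k z.
Proof.
apply: sume_ge0 => c _; rewrite mule_ge0 ?stick_mom_ge0//.
apply: prode_ge0 => i _; apply: integral_ge0 => y _.
by apply: prode_ge0 => j _; case/andP : (cell_law01 x k j (z.1, y)).
Qed.

Lemma measurable_mixed_moment x l k : measurable_fun setT (mixed_moment x l k).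
Proof.
rewrite /mixed_moment /dp_moment; under eq_fun do rewrite big_mkcond.
apply: emeasurable_sum => c; case: (c \in _); last exact: measurable_cst.
apply: emeasurable_funM; first exact: measurable_cst.
apply: emeasurable_prod => i _.
apply: (@measurable_fun_kernel_integral R _ _ _ Y _ (par_space pr) snd fst
  (fun z => \prod_(j | (l (tag j) == k :> nat) && (c j == i)) cell_law x k j z)).
- exact: measurable_snd.
- exact: measurable_fst.
- by apply: emeasurable_prod => j _; exact: measurable_cell_law.
- by move=> z; apply: prode_ge0 => j _; case/andP : (cell_law01 x k j z).
Qed.

(** The subgroup measures are averaged under DP(gamma, G_0) at level [Ko], and [dp_moment_le]
    removes the dependence on that level. What remains mentions only the parameters and G_0, whose
    layers are specified alike in both models. *)
Lemma mixture_ge x (l : {ffun 'I_m -> 'I_N.+1}) :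
  stick_mom nu N.+1 predT (fun j => l j) *
    \int[P]_w \prod_(k < N.+1) mixed_moment x l k (par M w, G0 M w) <=
  \int[P]_w (\prod_j (clip_stick (sub_stick M) w (l j))%:E *
    \prod_(k < N.+1) mixed_mass x l k (par M w, sub_measure M k w)).
Proof.
have [DPK DPKP DPKspec] := @sub_measure_spec R m n D nu gamma s pr Lo Ko M.
have mG2 : measurable_fun [set: g_sigma_algebraType h2] (G0 M).
  by apply: measurable_fun_events => A HA; right.
have mpar2 : measurable_fun [set: g_sigma_algebraType h2] (par M).
  exact: measurable_fun_sigmaS measurable_par1.
have mK2 : measurable_fun [set: g_sigma_algebraType h2] (fun w => DPK (G0 M w)).
  exact: (measurableT_comp (measurable_funPT DPK) mG2).
have := stick_mixture_integral (l := fun j => l j) (g := mixed_mass x l) (U := par M)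
  hist2M nu0 (@sub_stick_spec R m n D nu gamma s pr Lo Ko M) hL predT
  sub_measure_stick DPKspec mK2 mpar2 (fun j => ltn_ord (l j))
  (measurable_mixed_mass x l) (mixed_mass01 x l).
move=> ->; apply: lee_wpmul2l; first exact: stick_mom_ge0.
have mG := measurable_fun_sub hist2M mG2.
have mpar := measurable_fun_sub hist2M mpar2.
apply: ge0_le_integral => //.
- by move=> w _; apply: prode_ge0 => k _; exact: mixed_moment_ge0.
- apply: emeasurable_prod => k _.
  apply: (measurableT_comp (measurable_mixed_moment x l k)).
  exact: measurable_fun_pair.
- apply: emeasurable_prod => k _.
  apply: measurable_fun_kernel_integral.
  + exact: (measurable_fun_sub hist2M mK2).
  + exact: mpar.
  + exact: measurable_mixed_mass.
  + by move=> z; case/andP : (mixed_mass01 x l k z).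
- move=> w _; apply: prode_le => k _; rewrite mixed_moment_ge0 /=.
  exact: (@dp_moment_le R _ Y (G0 M w) gamma gamma0 (cell n) (fun c => l (tag c) == k :> nat)
    (fun c y => cell_law x k c (par M w, y)) (fun c => measurable_cell_law_pair x k c (par M w))
    (fun c y => cell_law01 x k c (par M w, y)) Ko (DPK (G0 M w)) k0 (DPKP (G0 M w)) hK).
Qed.

Lemma data_event_ge_mixture x :
  \sum_(l : {ffun 'I_m -> 'I_N.+1}) stick_mom nu N.+1 predT (fun j => l j) *
    \int[P]_w \prod_(k < N.+1) mixed_moment x l k (par M w, G0 M w) <= P (data_event x).
Proof.
apply: le_trans (data_event_ge x); apply: lee_sum => l _.
rewrite label_data_event label_effect_integral.
under [leRHS]eq_integral do rewrite prod_mixed_mass.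
by rewrite label_integral; exact: mixture_ge.
Qed.

End one_model.
End model_lower_bound.

(** * The common minorant *)

Section esum_scale.
Local Open Scope ereal_scope.
Lemma esumZl (R : realType) (T : countType) (c : \bar R) (a : T -> \bar R) :
  0 <= c <= 1 -> (forall x, 0 <= a x) ->
  \esum_(x in [set: T]) (c * a x) = c * \esum_(x in [set: T]) a x.
Proof.
move=> c01 a0; have [r cE] : exists r, c = r%:E by exists (fine c); rewrite fineK// fin_num01.
rewrite !esum_countE//; last by move=> x; rewrite mule_ge0//; case/andP : c01.
rewrite cE -nneseriesZl; last by move=> i _; case: pickle_inv => //=.
by apply: eq_eseriesr => i _; case: pickle_inv => //=; rewrite mule0.
Qed.
End esum_scale.



Section common_part.
Local Open Scope ereal_scope.
Context (R : realType) (m : nat) (n : 'I_m -> nat) (D : nat) (nu gamma : R)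
  (s : cell n -> R) (pr : prior R D) (N k0 : nat).
Hypotheses (nu0 : (0 < nu)%R) (gamma0 : (0 < gamma)%R).

Local Notation Y := (borel_space R D).
Local Notation labels := {ffun 'I_m -> 'I_N.+1}.
Local Notation allocations := {ffun 'I_N.+1 -> {ffun cell n -> 'I_k0.+1}}.

Definition in_subgroup (l : labels) (k : nat) : pred (cell n) := fun c => l (tag c) == k :> nat.

(* The (subgroup, atom) pair of a cell: conditionally on G_0 cells in the same
   block share one mu drawn from G_0. *)
Definition block (l : labels) (kk : allocations) (cg : cell n * 'I_D) : 'I_N.+1 * 'I_k0.+1 :=
  (l (tag cg.1), kk (l (tag cg.1)) cg.1).

Definition block_law x (l : labels) (kk : allocations) (b : 'I_N.+1 * 'I_k0.+1) (z : par_space pr * Y) : \bar R :=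
  \prod_(cg | block l kk cg == b) count_law s cg (l (tag cg.1)) (x cg) z.

Definition block_mass x (l : labels) (kk : allocations) (z : par_space pr * pprobability Y R) : \bar R :=
  \prod_b \int[z.2 : probability Y R]_y block_law x l kk b (z.1, y).

(** For each subgroup, a choice of atoms for its own cells. Cells of other subgroups are pinned to
    [ord0], so that no choice is counted twice. *)
Definition allocation_set (l : labels) : pred allocations :=
  [pred kk | kk \in family (fun k : 'I_N.+1 => mem (pffun_on (ord0 : 'I_k0.+1) (in_subgroup l k) predT))].

Definition allocation_mom (l : labels) (kk : allocations) : \bar R :=
  \prod_(k < N.+1) stick_mom gamma k0.+1 (in_subgroup l k) (fun c => kk k c).

Lemma block_law01 x l kk b z : 0 <= block_law x l kk b z <= 1.
Proof. by apply: prode_01 => cg _; exact: count_law01. Qed.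

Lemma measurable_block_law x l kk b : measurable_fun setT (block_law x l kk b).
Proof. by apply: emeasurable_prod => cg _; exact: measurable_count_law. Qed.

Lemma measurable_block_law_pair x l kk b t : measurable_fun setT (fun y : Y => block_law x l kk b (t, y)).
Proof. by apply: (measurableT_comp (measurable_block_law _ _ _ _)); exact: measurable_pair1. Qed.

Lemma block_mass01 x l kk z : 0 <= block_mass x l kk z <= 1.
Proof.
apply: prode_01 => b _; apply: integral01; first exact: measurable_block_law_pair.
by move=> y; exact: block_law01.
Qed.

Lemma measurable_block_mass x l kk : measurable_fun setT (block_mass x l kk).
Proof.
apply: emeasurable_prod => b _.
apply: (@measurable_fun_kernel_integral R _ _ _ Y _ (par_space pr) snd fst (block_law x l kk b)).
- exact: measurable_snd.
- exact: measurable_fst.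
- exact: measurable_block_law.
- by move=> z; case/andP : (block_law01 x l kk b z).
Qed.

Lemma allocation_mom01 l kk : 0 <= allocation_mom l kk <= 1.
Proof. by apply: prode_01 => k _; exact: stick_mom01. Qed.

(** The product over subgroups of sums over atom choices becomes a sum over joint allocations. *)
Lemma prod_mixed_moment x (l : labels) z :
  \prod_(k < N.+1) mixed_moment gamma s k0 x l k z =
  \sum_(kk | allocation_set l kk) allocation_mom l kk * block_mass x l kk z.
Proof.
rewrite /mixed_moment /dp_moment.
rewrite (prode_sume_distr_dep (fun k : 'I_N.+1 => mem (pffun_on (ord0 : 'I_k0.+1) (in_subgroup l k) predT))
 (F := fun (k : 'I_N.+1) (c : {ffun cell n -> 'I_k0.+1}) => stick_mom gamma k0.+1 (in_subgroup l k) (fun j => c j) *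
    \prod_(i < k0.+1) \int[z.2 : probability Y R]_y
      \prod_(j | in_subgroup l k j && (c j == i)) cell_law s x k j (z.1, y))).
  apply: eq_bigr => kk _; rewrite big_split /=; congr (_ * _).
  (* Products over subgroup and atom merge into one over blocks, and those over cell and coordinate
     into one over the counts of a block. *)
  rewrite pair_bigA /=; apply: eq_bigr => -[k i] _ /=; apply: eq_integral => y _.
  rewrite /cell_law pair_big /= /block_law.
  apply: eq_big => -[c g] /=.
    rewrite andbT /in_subgroup /block /= xpair_eqE.
    by rewrite -[X in _ = X && _]val_eqE /=; case: eqP => //= /val_inj ->.
  by rewrite andbT => /andP[/eqP <- _].
move=> k c; apply: mule_le1; first exact: stick_mom01.
apply: prode_01 => i _; apply: integral01.
  apply: emeasurable_prod => j _.
  by apply: (measurableT_comp (measurable_cell_law _ _ _ _)); exact: measurable_pair1.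
by move=> y; apply: prode_01 => j _; exact: cell_law01.
Qed.

(** Each model supplies its own kernel [DP0], and the two need not be the same object. Conditioning
    on the parameters leaves a moment of [DP0 t] averaged over the common prior, and
    [is_DP_moment_unique] equates these moments for every t. *)
Lemma G0_integral_eq Lo1 Ko1 Lo2 Ko2 (M1 : scsc_model nu gamma s pr Lo1 Ko1)
  (M2 : scsc_model nu gamma s pr Lo2 Ko2) x l kk :
  \int[sample_law M1]_w block_mass x l kk (par M1 w, G0 M1 w) =
  \int[sample_law M2]_w block_mass x l kk (par M2 w, G0 M2 w).
Proof.
have H Lo Ko (M : scsc_model nu gamma s pr Lo Ko) : exists DP0 :
    par_space pr -> pprobability (pprobability Y R) R,
    (forall t, is_DP None (alpha pr t) (base pr t) (DP0 t)) /\
    \int[sample_law M]_w block_mass x l kk (par M w, G0 M w) =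
    \int[par_law pr]_t \int[DP0 t : probability _ R]_G block_mass x l kk (t, G).
  have [DP0 HDP0 HG0] := @G0_spec R m n D nu gamma s pr Lo Ko M.
  exists DP0; split => //.
  have hist1M : @hist1 R m n D nu gamma s pr Lo Ko M `<=` measurable.
    by apply: events_of1_measurable; exact: measurable_funPT.
  have mpar1 : measurable_fun [set: g_sigma_algebraType (@hist1 R m n D nu gamma s pr Lo Ko M)] (par M).
    exact: measurable_fun_events.
  have mF : measurable_fun setT (fun t => \int[DP0 t : probability _ R]_G block_mass x l kk (t, G)).
    apply: (@measurable_fun_kernel_integral R _ _ _ (pprobability Y R) _ (par_space pr) DP0 id).
    - exact: measurable_funPT.
    - exact: measurable_id.
    - exact: measurable_block_mass.
    - by move=> z; case/andP : (block_mass01 x l kk z).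
  rewrite (@eq_measure_integral _ _ _ setT (pushforward (sample_law M) (par M))); last first.
    by move=> A mA _; rewrite /pushforward; symmetry; exact: (@par_spec R m n D nu gamma s pr Lo Ko M A mA).
  rewrite ge0_integral_pushforward; [|exact: measurable_funPT|exact: measurableT|exact: mF|]; last first.
    by move=> t _; apply: integral_ge0 => G _; case/andP : (block_mass01 x l kk (t, G)).
  (* [cond_law] is conditional independence indexed by [unit], hence the one-element list. *)
  have H0 := cond_indep_integral hist1M (W := fun _ : unit => G0 M) _ HG0
    (K := fun _ w => DP0 (par M w)) _ _ (U := par M) (Z := fun=> 1) (s := [:: tt]) (g := fun _ => block_mass x l kk) mpar1.
  transitivity (\int[sample_law M]_w (1 * \prod_(i <- [:: tt]) block_mass x l kk (par M w, G0 M w))).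
    by apply: eq_integral => w _; rewrite big_seq1 mul1e.
  move: H0 => ->.
  - by apply: eq_integral => w _; rewrite big_seq1 mul1e.
  - by move=> _; exact: measurable_funPT.
  - move=> _; exact: measurableT_comp.
  - by [].
  - exact: measurable_cst.
  - by move=> w; rewrite lee01 lexx.
  - by [].
  - by [].
  - by move=> _; exact: measurable_block_mass.
  - by move=> _ z; exact: block_mass01.
have [D1 [H1 ->]] := H _ _ M1; have [D2 [H2 ->]] := H _ _ M2.
apply: eq_integral => t _.
exact: (@is_DP_moment_unique R _ Y (base pr t) (alpha pr t) (alpha_gt0 t) _ predT
  (fun b y => block_law x l kk b (t, y)) (fun b => measurable_block_law_pair x l kk b t)
  (fun b y => block_law01 x l kk b (t, y)) _ _ (H1 t) (H2 t)).
Qed.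

End common_part.

Section retained_mass.
Context (R : realType).

(** The mean total weight of the first N sticks. *)
Definition retained (a : R) (N : nat) : R := 1 - (a / (a + 1)) ^+ N.

Lemma retained01 (a : R) N : 0 < a -> 0 <= retained a N <= 1.
Proof.
move=> a0; have q0 : 0 <= a / (a + 1) by rewrite divr_ge0// ltW// addr_gt0.
have q1 : a / (a + 1) <= 1 by rewrite ler_pdivrMr ?mul1r ?lerDl// addr_gt0.
by rewrite /retained subr_ge0 exprn_ile1// lerBlDr lerDl exprn_ge0.
Qed.

End retained_mass.

Section minorant.
Local Open Scope ereal_scope.
Context (R : realType) (m : nat) (n : 'I_m -> nat) (D : nat) (nu gamma : R)
  (s : cell n -> R) (pr : prior R D) (N k0 : nat).
Hypotheses (nu0 : (0 < nu)%R) (gamma0 : (0 < gamma)%R).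

Local Notation Y := (borel_space R D).

(** Each subgroup contributes at least [retained] to the power of its number of cells, and these
    numbers add up to the number of all cells. The process [DP0] provides a probability space
    carrying the sticks. *)
Lemma sum_allocation_mom_ge (Ko : option nat) (P0 : probability Y R) DP0 (l : {ffun 'I_m -> 'I_N.+1}) :
  (forall k, (k < k0.+1)%N -> stick_index Ko k) -> is_DP Ko gamma P0 DP0 ->
  (retained gamma k0.+1 ^+ (\sum_(j < m) n j)%N)%:E <=
  \sum_(kk | allocation_set (n := n) (k0 := k0) l kk) allocation_mom gamma l kk.
Proof.
move=> hK [d' [ Omega [P [psi [theta [G [Hpsi _ _ _]]]]]]].
have <- : #|{: cell n}| = (\sum_(j < m) n j)%N.
  by rewrite card_tagged sumnE big_map big_enum; apply: eq_bigr => j _; rewrite card_ord.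
rewrite /allocation_mom.
rewrite -(prode_sume_distr_dep (fun k : 'I_N.+1 => mem (pffun_on (ord0 : 'I_k0.+1) (in_subgroup l k) predT))
 (F := fun (k : 'I_N.+1) (c : {ffun cell n -> 'I_k0.+1}) => stick_mom gamma k0.+1 (in_subgroup l k) (fun j => c j)));
  last by move=> k c; exact: stick_mom01.
have -> : #|{: cell n}| = (\sum_(k < N.+1) #|in_subgroup (n := n) l k|)%N.
  rewrite -sum1_card (partition_big (fun c => l (tag c)) xpredT)//=.
  by apply: eq_bigr => k _; rewrite -sum1_card; apply: eq_bigl => c.
rewrite -prodrXr -prodEFin; apply: prode_le => k _.
have /andP[r0 _] := retained01 k0.+1 gamma0.
rewrite lee_fin exprn_ge0//=.
have HM : (set0 : set (set Omega)) `<=` measurable by [].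
exact: (sum_stick_mom_ge HM gamma0 Hpsi hK).
Qed.

Section one_model.
Variables (Lo Ko : option nat) (M : scsc_model nu gamma s pr Lo Ko).
Hypothesis hL : forall k, (k < N.+1)%N -> stick_index Lo k.
Hypothesis hK : forall k, (k < k0.+1)%N -> stick_index Ko k.

(** The model enters only through the joint law of parameters and G_0, so that [minorant_eq] can
    identify the minorants of two models. *)
Definition minorant (x : data n D) : \bar R :=
  \sum_(l : {ffun 'I_m -> 'I_N.+1}) stick_mom nu N.+1 predT (fun j => l j) *
    \sum_(kk | allocation_set (k0 := k0) l kk) allocation_mom gamma l kk *
       \int[sample_law M]_w block_mass s x l kk (par M w, G0 M w).

Lemma measurable_model_block_mass x l kk :
  measurable_fun setT (fun w => block_mass (N := N) (k0 := k0) s x l kk (par M w, G0 M w)).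
Proof.
apply: (measurableT_comp (measurable_block_mass s x l kk)).
by apply: measurable_fun_pair; exact: measurable_funPT.
Qed.

Lemma integral_block_mass_ge0 x l kk :
  0 <= \int[sample_law M]_w block_mass (N := N) (k0 := k0) s x l kk (par M w, G0 M w).
Proof. by apply: integral_ge0 => w _; case/andP : (block_mass01 s x l kk (par M w, G0 M w)). Qed.

Lemma minorant_le x : minorant x <= sample_law M (data_event (M := M) x).
Proof.
apply: le_trans (data_event_ge_mixture nu0 gamma0 M hL hK x).
apply: lee_sum => l _; apply: lee_wpmul2l; first exact: stick_mom_ge0.
under [leRHS]eq_integral do rewrite prod_mixed_moment// big_mkcond/=.
rewrite ge0_integral_sum//.
- rewrite big_mkcond /=; apply: lee_sum => kk _; case: ifPn => _; last by rewrite integral0.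
  rewrite ge0_integralZl//.
  + exact: measurable_model_block_mass.
  + by move=> w _; case/andP : (block_mass01 s x l kk (par M w, G0 M w)).
  + by case/andP : (allocation_mom01 gamma0 l kk).
- move=> kk; case: (allocation_set l kk); last exact: measurable_cst.
  by apply: emeasurable_funM; [exact: measurable_cst|exact: measurable_model_block_mass].
- move=> kk w _; case: (allocation_set l kk) => //; rewrite mule_ge0//.
  + by case/andP : (allocation_mom01 gamma0 l kk).
  + by case/andP : (block_mass01 s x l kk (par M w, G0 M w)).
Qed.

Lemma minorant_ge0 x : 0 <= minorant x.
Proof.
apply: sume_ge0 => l _; rewrite mule_ge0 ?stick_mom_ge0//.
apply: sume_ge0 => kk _; rewrite mule_ge0 ?integral_block_mass_ge0//.
by case/andP : (allocation_mom01 gamma0 l kk).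
Qed.

(** Given parameters, G_0, labels and allocation, [block_mass] is the probability of the array x:
    blocks are independent and each shares one draw from G_0. *)
Lemma esum_block_mass_ge1 l kk :
  1 <= \esum_(x in [set: data n D])
         \int[sample_law M]_w block_mass (N := N) (k0 := k0) s x l kk (par M w, G0 M w).
Proof.
rewrite -(@ge0_integral_esum R _ _ (sample_law M) {ffun cell n * 'I_D -> nat}
  (fun x w => block_mass (N := N) (k0 := k0) s x l kk (par M w, G0 M w))).
- rewrite -(@integral_prob_cst _ _ _ (sample_law M) 1).
  apply: ge0_le_integral => //.
  + apply: measurable_esum => [x|x w]; first exact: measurable_model_block_mass.
    by case/andP : (block_mass01 s x l kk (par M w, G0 M w)).
  + move=> w _.
    apply: (@esum_prod_integral_ge1 R _ Y (G0 M w) (cell n * 'I_D)%type _ (block l kk)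
      (fun cg v y => count_law s cg (l (tag cg.1)) v (par M w, y))).
    * move=> cg v; apply: (measurableT_comp (measurable_count_law _ _ _ _)); exact: measurable_pair1.
    * by move=> cg v y; exact: count_law01.
    * by move=> cg y; exact: zipln_sum1.
- by move=> x; exact: measurable_model_block_mass.
- by move=> x w; case/andP : (block_mass01 s x l kk (par M w, G0 M w)).
Qed.

Lemma esum_minorant_ge :
  (retained nu N.+1 ^+ m * retained gamma k0.+1 ^+ (\sum_(j < m) n j)%N)%:E <=
  \esum_(x in [set: data n D]) minorant x.
Proof.
have /andP[r0 r1] := retained01 k0.+1 gamma0.
have alloc0 l kk : 0 <= allocation_mom (n := n) (N := N) (k0 := k0) gamma l kk <= 1.
  exact: allocation_mom01.
have inner0 x (l : {ffun 'I_m -> 'I_N.+1}) :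
    0 <= \sum_(kk | allocation_set (k0 := k0) l kk) allocation_mom gamma l kk *
       \int[sample_law M]_w block_mass s x l kk (par M w, G0 M w).
  apply: sume_ge0 => kk _; rewrite mule_ge0 ?integral_block_mass_ge0//.
  by case/andP : (alloc0 l kk).
rewrite /minorant esum_sum; last first.
  by move=> x l _ _; rewrite mule_ge0 ?stick_mom_ge0.
rewrite EFinM.
have sticks : (retained nu N.+1 ^+ m)%:E <=
    \sum_(l : {ffun 'I_m -> 'I_N.+1}) stick_mom nu N.+1 predT (fun j => l j).
  have hist2M : @hist2 R m n D nu gamma s pr Lo Ko M `<=` measurable.
    by rewrite subUset; split => //; apply: events_of1_measurable; exact: measurable_funPT.
  have := sum_stick_mom_ge hist2M nu0 (@sub_stick_spec R m n D nu gamma s pr Lo Ko M) hL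
    (J := 'I_m) predT ord0.
  rewrite cardT size_enum_ord; move=> /le_trans; apply.
  (* Over [predT] no coordinate is pinned to the default, so [pffun_on] ranges over all label
     assignments. *)
  rewrite le_eqVlt; apply/orP; left; apply/eqP; apply: eq_bigl => l.
  by apply/pffun_onP; split; [exact: subset_predT|].
apply: (le_trans (lee_wpmul2r _ sticks)); first by rewrite lee_fin exprn_ge0.
rewrite ge0_sume_distrl; last by move=> l _; exact: stick_mom_ge0.
apply: lee_sum => l _.
rewrite (@esumZl R {ffun cell n * 'I_D -> nat}); last 2 first.
- exact: stick_mom01.
- by move=> x; exact: inner0.
apply: lee_wpmul2l; first exact: stick_mom_ge0.
have [DPK DPKP _] := @sub_measure_spec R m n D nu gamma s pr Lo Ko M.
(* The bound depends on [gamma] alone and [DPKP] holds for every base measure; a Dirac mass is a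
   convenient choice. *)
have := sum_allocation_mom_ge l hK (DPKP (@dirac _ Y (0%R : 'rV[R]_D) R : probability Y R)).
move=> /le_trans; apply.
rewrite esum_sum; last first.
  move=> x kk _ _; rewrite mule_ge0 ?integral_block_mass_ge0//.
  by case/andP : (alloc0 l kk).
apply: lee_sum => kk _.
rewrite (@esumZl R {ffun cell n * 'I_D -> nat}); last 2 first.
- exact: alloc0.
- by move=> x; exact: integral_block_mass_ge0.
by rewrite -[leLHS]mule1; apply: lee_wpmul2l; [case/andP : (alloc0 l kk)|exact: esum_block_mass_ge1].
Qed.

End one_model.

Lemma minorant_eq Lo1 Ko1 Lo2 Ko2 (M1 : scsc_model nu gamma s pr Lo1 Ko1)
  (M2 : scsc_model nu gamma s pr Lo2 Ko2) x : minorant M1 x = minorant M2 x.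
Proof.
apply: eq_bigr => l _; congr (_ * _); apply: eq_bigr => kk _; congr (_ * _).
exact: G0_integral_eq.
Qed.

End minorant.

(** * From a common minorant to an L1 distance *)

Section total_variation.
Local Open Scope ereal_scope.
Context (R : realType).

Lemma esum_probability_le1 d (Omega : measurableType d) (P : probability Omega R)
    (T : choiceType) (E : T -> set Omega) :
  (forall x, measurable (E x)) -> trivIset setT E ->
  \esum_(x in [set: T]) P (E x) <= 1.
Proof.
move=> mE tE; apply: ge_ereal_sup => _ [A [finA _] <-].
rewrite -measure_fin_bigcup//; last exact: sub_trivIset tE.
by apply: probability_le1; exact: fin_bigcup_measurable.
Qed.

(* [2 min(p1, p2) = p1 + p2 - |p1 - p2|], and [q] is below the minimum. *)
Lemma esum_dist_le (T : choiceType) (p1 p2 : T -> R) (q : T -> \bar R) (B : R) :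
  (forall x, 0 <= q x) -> (forall x, q x <= (p1 x)%:E) -> (forall x, q x <= (p2 x)%:E) ->
  \esum_(x in [set: T]) (p1 x)%:E <= 1 -> \esum_(x in [set: T]) (p2 x)%:E <= 1 ->
  B%:E <= \esum_(x in [set: T]) q x -> (B <= 1)%R ->
  (4^-1)%:E * (\esum_(x in [set: T]) `|p1 x - p2 x|%:E) <= (1 - B)%:E.
Proof.
move=> q0 q1 q2 e1 e2 eB B1.
have p10 x : 0 <= (p1 x)%:E by exact: le_trans (q1 x).
have p20 x : 0 <= (p2 x)%:E by exact: le_trans (q2 x).
(* The minorant is added on the left, which avoids subtracting extended-real sums before the
   distance is known to be finite. *)
have H : \esum_(x in [set: T]) `|p1 x - p2 x|%:E + (B%:E + B%:E) <= 1 + 1.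
  apply: (@le_trans _ _ (\esum_(x in [set: T]) ((p1 x)%:E + (p2 x)%:E))); last first.
    by rewrite esumD//; exact: leeD.
  apply: (@le_trans _ _ (\esum_(x in [set: T]) (`|p1 x - p2 x|%:E + (q x + q x)))).
    rewrite esumD//; last by move=> x _; rewrite adde_ge0.
    by rewrite leeD2l// esumD//; exact: leeD.
  apply: le_esum => x _.
  have := q1 x; have := q2 x; have := q0 x.
  case: (q x) => [r||] //; rewrite !lee_fin => r0 r2 r1.
  by have [h|h] := ler0P (p1 x - p2 x)%R; lra.
have S0 : 0 <= \esum_(x in [set: T]) `|p1 x - p2 x|%:E by apply: esum_ge0.
move: S0 H; case: (\esum_(x in _) _) => [S||] //; rewrite !lee_fin => S0 H.
(* The sum is at most 2 - 2B; a quarter of it is at most (1 - B) / 2, and [B <= 1] bounds this by 1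
   - B. *)
lra.
Qed.

End total_variation.

Lemma marginalE (R : realType) (m : nat) (n : 'I_m -> nat) (D : nat) (nu gamma : R)
    (s : cell n -> R) (pr : prior R D) (Lo Ko : option nat)
    (M : scsc_model nu gamma s pr Lo Ko) (x : data n D) :
  (marginal M x)%:E = sample_law M (data_event (M := M) x).
Proof. by rewrite /marginal fineK// fin_num_measure//; exact: measurable_data_event. Qed.

Lemma esum_marginal_le1 (R : realType) (m : nat) (n : 'I_m -> nat) (D : nat) (nu gamma : R)
    (s : cell n -> R) (pr : prior R D) (Lo Ko : option nat)
    (M : scsc_model nu gamma s pr Lo Ko) :
  (\esum_(x in [set: data n D]) (marginal M x)%:E <= 1)%E.
Proof.
rewrite (eq_esum (fun x _ => marginalE M x)).
apply: esum_probability_le1 => [x|x y _ _ [w [Hx Hy]]]; first exact: measurable_data_event.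
by apply/ffunP => cg; rewrite -Hx -Hy.
Qed.

Lemma common_minorant (R : realType) (m : nat) (n : 'I_m -> nat) (D K L : nat)
    (nu gamma : R) (s : cell n -> R) (pr : prior R D)
    (Minf : scsc_model nu gamma s pr None None)
    (MKL : scsc_model nu gamma s pr (Some L) (Some K)) :
  (0 < m)%N -> (forall j, 0 < n j)%N -> (0 < K)%N -> (0 < L)%N -> 0 < nu -> 0 < gamma ->
  exists q : data n D -> \bar R, [/\ forall x, (0 <= q x)%E,
    forall x, (q x <= (marginal MKL x)%:E)%E, forall x, (q x <= (marginal Minf x)%:E)%E &
    ((retained nu (L - 1) ^+ m * retained gamma (K - 1) ^+ (\sum_(j < m) n j)%N)%:E <=
      \esum_(x in [set: data n D]) q x)%E].
Proof.
move=> m0 n0 K0 L0 nu0 gamma0.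
have retained0 a : retained (R := R) a 0 = 0 by rewrite /retained expr0 subrr.
(* For L = 1 the only weight is the remainder, [retained nu 0] vanishes and, since m is positive, so
   does the bound: the zero minorant suffices. *)
case: L L0 MKL => // -[|N] _ MKL.
  exists (fun=> 0%E); split => [//|x|x|]; rewrite ?marginalE ?measure_ge0//.
  by rewrite retained0 expr0n eqn0Ngt m0 mul0r; exact: esum_ge0.
(* K = 1 is treated alike; the exponent is positive because the first subject has a cell. *)
case: K K0 MKL => // -[|k0] _ MKL.
  exists (fun=> 0%E); split => [//|x|x|]; rewrite ?marginalE ?measure_ge0//.
  rewrite retained0 expr0n (bigD1 (Ordinal m0))//= addn_eq0 eqn0Ngt n0 mulr0.
  exact: esum_ge0.
have infN k : (k < N.+1)%N -> stick_index None k by [].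
have infk k : (k < k0.+1)%N -> stick_index None k by [].
(* Here L = N + 2 and K = k0 + 2, so the N + 1 labels and k0 + 1 atoms kept are exactly those before
   the remainder weights. *)
rewrite !subSS !subn0; exists (minorant N k0 Minf); split.
- by move=> x; exact: minorant_ge0.
- by move=> x; rewrite marginalE (minorant_eq N k0 Minf MKL); exact: minorant_le.
- by move=> x; rewrite marginalE; exact: minorant_le.
- exact: esum_minorant_ge.
Qed.

Theorem theorem1 (R : realType) (m : nat) (n : 'I_m -> nat) (D K L : nat)
  (nu gamma : R) (s : cell n -> R) (pr : prior R D)
  (hm : (1 <= m)%N) (hn : forall j, (1 <= n j)%N) (hD : (1 <= D)%N)
  (hK : (1 <= K)%N) (hL : (1 <= L)%N)
  (hnu : 0 < nu) (hgamma : 0 < gamma) (hs : forall c, 0 < s c)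
  (Minf : scsc_model nu gamma s pr None None)
  (MKL : scsc_model nu gamma s pr (Some L) (Some K)) :
  ((4^-1)%:E *
     (\esum_(x in [set: data n D]) `|marginal MKL x - marginal Minf x|%:E)
   <= (1 - (1 - (nu / (nu + 1)) ^+ (L - 1)) ^+ m
         * (1 - (gamma / (gamma + 1)) ^+ (K - 1)) ^+ (\sum_(j < m) n j)%N)%:E)%E.
Proof.
have [q [q0 q1 q2 qB]] := common_minorant Minf MKL hm hn hK hL hnu hgamma.
apply: esum_dist_le q0 q1 q2 _ _ qB _; [exact: esum_marginal_le1|exact: esum_marginal_le1|].
have /andP[n0 n1] := retained01 (L - 1) hnu; have /andP[g0 g1] := retained01 (K - 1) hgamma.
by rewrite mulr_ile1 ?exprn_ge0 ?exprn_ile1.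
Qed.
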